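(* For all positive integers $m,d,n$ one has $$\mathcal{Q}_c^n=\bigcap_{\varepsilon>0}\mathcal{Q}_\varepsilon^n=\bigcap_{\varepsilon>0}\mathcal{P}_\varepsilon^n ,$$ where the sets $\mathcal{Q}_c^n,\mathcal{Q}_\varepsilon^n,\mathcal{P}_\varepsilon^n$ (which depend on $m$ and $d$) are defined in the context. In particular, for given $m,d$, an affirmative answer to Tsirelson's problem, i.e. the equality $\mathcal{Q}_c=\mathcal{Q}_s$, is equivalent to the inclusion $\bigcap_{\varepsilon>0}\mathcal{P}_\varepsilon\subset\mathcal{Q}_s$.
   Context: All Hilbert spaces are complex. A POVM with $m$ outputs on a Hilbert space $\mathcal{H}$ is an $m$-tuple $(A_i)_{i=1}^m$ of positive semi-definite bounded operators on $\mathcal{H}$ with $\sum_i A_i=1$. It is projective if every $A_i$ is an orthogonal projection. Write $[A,B]=AB-BA$, let $\|\cdot\|$ be the operator norm, and for positive semi-definite $A,B$ put $A\bullet B=\frac12\left(A^{1/2}BA^{1/2}+B^{1/2}AB^{1/2}\right)$. Fix positive integers $m,d,n$. Superscripts $k,l\in\{1,\dots,d\}$ are indices (not powers), and $i,j\in\{1,\dots,m\}$. The arrays below are indexed by rows $(k,i)$ and columns $(l,j)$ and are viewed as elements of $\mathbb{M}_{md}(\mathbb{M}_n(\mathbb{C}))$; closures are in this finite-dimensional space. $\mathcal{Q}_c^n$ is the set of all arrays $[V^*A_i^kB_j^lV]_{k,l;i,j}$, where $\mathcal{H}$ is a Hilbert space, $V:\ell_2^n\to\mathcal{H}$ is an isometry,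 $(A_i^k)_{i=1}^m$ ($k=1,\dots,d$) and $(B_j^l)_{j=1}^m$ ($l=1,\dots,d$) are POVMs on $\mathcal{H}$, and $[A_i^k,B_j^l]=0$ for all $i,j,k,l$. For $\varepsilon>0$, $\mathcal{Q}_\varepsilon^n$ is the closure of the set of all arrays $[V^*(A_i^k\bullet B_j^l)V]_{k,l;i,j}$, where $\dim\mathcal{H}<\infty$, $V:\ell_2^n\to\mathcal{H}$ is an isometry, $(A_i^k)_{i=1}^m$ ($k=1,\dots,d$) and $(B_j^l)_{j=1}^m$ ($l=1,\dots,d$) are POVMs on $\mathcal{H}$, and $\|[A_i^k,B_j^l]\|\le\varepsilon$ for all $i,j,k,l$. For $\varepsilon>0$, $\mathcal{P}_\varepsilon^n$ is the closure of the set of all arrays $[V^*(P_i^k\bullet Q_j^l)V]_{k,l;i,j}$, where $\dim\mathcal{H}<\infty$, $V:\ell_2^n\to\mathcal{H}$ is an isometry, $(P_i^k)_{i=1}^m$ ($k=1,\dots,d$) and $(Q_j^l)_{j=1}^m$ ($l=1,\dots,d$) are projective POVMs on $\mathcal{H}$, and $\|[P_i^k,Q_j^l]\|\le\varepsilon$ for all $i,j,k,l$. Write $\mathcal{P}_\varepsilon=\mathcal{P}_\varepsilon^1$. $\mathcal{Q}_c$ is the set of all arrays $[\langle\xi,A_i^kB_j^l\xi\rangle]_{k,l;i,j}$, where $\mathcal{H}$ is a Hilbert space, $\xi\in\mathcal{H}$ is a unit vector, and $(A_i^k)_{i=1}^m$, $(B_j^l)_{j=1}^m$ ($k,l=1,\dots,d$)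 are POVMs on $\mathcal{H}$ with $[A_i^k,B_j^l]=0$ for all $i,j,k,l$ (so $\mathcal{Q}_c=\mathcal{Q}_c^1$). $\mathcal{Q}_s$ is the closure of the set of all such arrays obtained with $\dim\mathcal{H}<\infty$. Tsirelson's problem (for given $m,d$) asks whether $\mathcal{Q}_c=\mathcal{Q}_s$. *)

(* Defs.v *)
From HB Require Import structures.
From mathcomp Require Import all_boot all_order all_algebra.
From mathcomp Require Import all_classical all_reals all_analysis.
From mathcomp Require Import complex.

Set Implicit Arguments.
Unset Strict Implicit.
Unset Printing Implicit Defensive.

Import Order.TTheory GRing.Theory Num.Theory.
Import numFieldNormedType.Exports.

Local Open Scope classical_set_scope.
Local Open Scope ring_scope.
Local Open Scope complex_scope.

(* A complex Hilbert space: a complete normed space over R[i] whose norm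
   (R[i]-valued, as for every normedModType R[i]) comes from an inner product. *)
Record hilbertType (R : realType) := Hilbert {
  hilbert_carrier :> completeNormedModType R[i];
  hilbert_form : {dot hilbert_carrier for @Num.conj R[i]};
  hilbert_normE : forall x, hilbert_form x x = `|x| ^+ 2 }.

Section HilbertSpace.
Variables (R : realType) (H : hilbertType R).
Implicit Types (S T : H -> H) (x y : H).

(* {dot _ for _} is linear in its first argument; the arguments are swapped
   so that <x, y> is linear in y, as in <xi, T xi> and V^* T V. *)
Definition inner x y : R[i] := hilbert_form H y x.

Definition finite_dim : Prop :=
  exists (N : nat) (e : 'I_N -> H),
    forall x, exists c : 'I_N -> R[i], x = \sum_(i < N) c i *: e i.

Definition bounded_op T : Prop :=
  linear T /\ exists M : R[i], forall x, `|T x| <= M * `|x|.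

(* Only meaningful for bounded T (sup of an unbounded set is 0). *)
Definition opnorm T : R := sup [set complex.Re `|T x| | x in [set x | `|x| <= 1]].

Definition commutator S T : H -> H := fun x => S (T x) - T (S x).

(* 0 <= z in R[i] means that z is real and nonnegative. *)
Definition psd T : Prop := bounded_op T /\ forall x, 0 <= inner x (T x).

Definition orth_proj T : Prop :=
  [/\ bounded_op T, forall x, T (T x) = T x &
      forall x y, inner (T x) y = inner x (T y)].

(* T^{1/2}: the positive semi-definite S with S^2 = T. *)
Definition psd_sqrt T : H -> H :=
  xget (fun=> 0) [set S : H -> H | psd S /\ forall x, S (S x) = T x].

Definition bullet S T : H -> H := fun x =>
  2^-1 *: (psd_sqrt S (T (psd_sqrt S x)) + psd_sqrt T (S (psd_sqrt T x))).

Definition povm m (A : 'I_m -> H -> H) : Prop :=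
  (forall i, psd (A i)) /\ forall x, \sum_(i < m) A i x = x.

Definition projective_povm m (A : 'I_m -> H -> H) : Prop :=
  povm A /\ forall i, orth_proj (A i).

(* l_2^n is 'cV_n with its Euclidean norm, not the sup norm that the library
   puts on matrices. *)
Definition l2_isometry n (V : {linear 'cV[R[i]]_n -> H}) : Prop :=
  forall v : 'cV_n, `|V v| ^+ 2 = \sum_(a < n) `|v a 0| ^+ 2.

(* V^* : H -> l_2^n, whose a-th coordinate at y is <V e_a, y>. *)
Definition adj n (V : {linear 'cV[R[i]]_n -> H}) (y : H) : 'cV[R[i]^o]_n :=
  \col_a inner (V (delta_mx a 0)) y.

Lemma adjP n (V : {linear 'cV[R[i]]_n -> H}) (v : 'cV_n) (y : H) :
  inner (V v) y = \sum_(a < n) (v a 0)^* * adj V y a 0.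
Proof.
rewrite {1}[v]matrix_sum_delta linear_sum /inner linear_sumr.
apply: eq_bigr => a _; rewrite big_ord1 linearZ /= linearZr_LR /=.
by rewrite /adj mxE.
Qed.

(* The matrix of V^* T V in the standard basis of l_2^n. *)
Definition compression n (V : {linear 'cV[R[i]]_n -> H}) T : 'M[R[i]^o]_n :=
  \matrix_(a, b) adj V (T (V (delta_mx b 0))) a 0.

End HilbertSpace.

Section Correlations.
Variables (R : realType) (m d : nat).

(* M_{md}(M_n(C)) with its product topology.  The row (k, i) is the row
   mxvec_index k i of the matrix; (k, i) |-> mxvec_index k i is a bijection
   from 'I_d * 'I_m to 'I_(d * m). *)
Definition corr_array (n : nat) := 'M['M[R[i]^o]_n]_(d * m).

Definition has_blocks n (X : corr_array n)
    (x : 'I_d -> 'I_m -> 'I_d -> 'I_m -> 'M[R[i]^o]_n) : Prop :=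
  forall k i l j, X (mxvec_index k i) (mxvec_index l j) = x k i l j.

Definition Qcn (n : nat) : set (corr_array n) :=
  [set X | exists (H : hilbertType R) (V : {linear 'cV[R[i]]_n -> H})
      (A B : 'I_d -> 'I_m -> H -> H),
    [/\ l2_isometry V, forall k, povm (A k), forall l, povm (B l),
        forall k i l j x, commutator (A k i) (B l j) x = 0 &
        has_blocks X (fun k i l j => compression V (A k i \o B l j))]].

Definition Qepsn (eps : R) (n : nat) : set (corr_array n) :=
  closure [set X : corr_array n | exists (H : hilbertType R)
      (V : {linear 'cV[R[i]]_n -> H}) (A B : 'I_d -> 'I_m -> H -> H),
    finite_dim H /\
    [/\ l2_isometry V, forall k, povm (A k), forall l, povm (B l),
        forall k i l j, opnorm (commutator (A k i) (B l j)) <= eps &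
        has_blocks X (fun k i l j => compression V (bullet (A k i) (B l j)))]].

Definition Pepsn (eps : R) (n : nat) : set (corr_array n) :=
  closure [set X : corr_array n | exists (H : hilbertType R)
      (V : {linear 'cV[R[i]]_n -> H}) (P Q : 'I_d -> 'I_m -> H -> H),
    finite_dim H /\
    [/\ l2_isometry V,
        forall k, projective_povm (P k), forall l, projective_povm (Q l),
        forall k i l j, opnorm (commutator (P k i) (Q l j)) <= eps &
        has_blocks X (fun k i l j => compression V (bullet (P k i) (Q l j)))]].

Definition Peps (eps : R) : set (corr_array 1) := @Pepsn eps 1.

(* The scalar <xi, A B xi> is identified with the 1 x 1 matrix
   <xi, A B xi>%:M. *)
Definition commuting_correlation (H : hilbertType R) (X : corr_array 1) : Prop :=
  exists (xi : H) (A B : 'I_d -> 'I_m -> H -> H),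
    [/\ `|xi| = 1, forall k, povm (A k), forall l, povm (B l),
        forall k i l j x, commutator (A k i) (B l j) x = 0 &
        has_blocks X (fun k i l j => (inner xi (A k i (B l j xi)))%:M)].

Definition Qc : set (corr_array 1) :=
  [set X | exists H : hilbertType R, commuting_correlation H X].

Definition Qs : set (corr_array 1) :=
  closure [set X : corr_array 1 | exists2 H : hilbertType R,
    finite_dim H & commuting_correlation H X].

End Correlations.

Arguments Qcn : clear implicits.
Arguments Qepsn : clear implicits.
Arguments Pepsn : clear implicits.
Arguments Peps : clear implicits.
Arguments Qc : clear implicits.
Arguments Qs : clear implicits.

(* Main.v *)
From HB Require Import structures.
Require Import Defs.
From mathcomp Require Import all_boot all_order all_algebra.
From mathcomp Require Import all_classical all_reals all_analysis.
From mathcomp Require Import complex generic_quotient.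
From mathcomp Require Import ring lra.

Set Implicit Arguments.
Unset Strict Implicit.
Unset Printing Implicit Defensive.

Import Order.TTheory GRing.Theory Num.Theory.
Import numFieldNormedType.Exports.

Local Open Scope classical_set_scope.
Local Open Scope ring_scope.
Local Open Scope complex_scope.

Import ComplexField.Normc.

(** The inclusions to prove form a cycle: [Qcn] is contained in every [Pepsn],
    [Pepsn] in [Qepsn], and the intersection of the [Qepsn] in [Qcn]. The middle
    one is immediate. The other two pass through [approx_model]: models of the
    array [X], up to an error [e], by finite-dimensional POVMs commuting up to
    [e].

    From commuting POVMs on any Hilbert space to approximate models
    ([finite_dim_approximation]): let [E 0] be the range of [V] and let every
    POVM element map [E k] into [E k.+1]. The average [g] of the projections on
    the first [N] of these finite-dimensional spaces fixes the range of [V], and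
    its commutators with the POVM elements are of order [1 / sqrt N]
    ([quasicentral_cutoff]). The operators [g A g], with [1 - g^2] added to one
    outcome, are then nearly commuting POVMs on a finite-dimensional space with
    nearly the same correlations.

    From approximate models to projective ones ([simultaneous_dilation]): the
    Naimark dilation is implemented by a self-adjoint unitary on [m + 1] copies
    of the space whose entries are polynomials in the square roots of the POVM
    elements, so it nearly commutes with every operator, amplified to the copies,
    with which these square roots nearly commute. It is applied to the first
    family, and then to the amplification of the second one.

    From approximate models with errors tending to zero to exactly commuting
    POVMs ([Qcn_of_approx]): take an ultraproduct of the Hilbert spaces.

    All three steps have to control square roots without reference to the
    dimension. The iteration [Y := (X + Y^2) / 2], with [X := 1 - T], converges in
    norm to [1 - T^{1/2}] at a rate independent of [T], and each iterate is a
    polynomial in [T], so that small commutators with [T] give small commutators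
    with [T^{1/2}] ([psd_sqrtP]). In particular the symmetrized product [bullet] is
    close to the ordinary one ([bullet_close]).

    For the last assertion, [Qc] is [Qcn] for [n = 1], so it equals the
    intersection of the [Peps]; and [Qs] lies in [Qc] because an array close to
    one with commuting models has approximate models. *)

(** * Complex scalars and semi-inner products *)

(** Aliases whose argument is a [realType], so that rewriting with the lemmas
    below finds the ring instance of [R[i]]. *)
Definition re (R : realType) (z : R[i]) : R := complex.Re z.
Definition im (R : realType) (z : R[i]) : R := complex.Im z.
Definition cabs (R : realType) (z : R[i]) : R := normc z.

Section ComplexScalars.
Variable R : realType.
Implicit Types z w : R[i].

Lemma complex_eqP z w : re z = re w -> im z = im w -> z = w.
Proof. by case: z; case: w => a b c d /= -> ->. Qed.

Lemma reD z w : re (z + w) = re z + re w. Proof. by case: z; case: w. Qed.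
Lemma imD z w : im (z + w) = im z + im w. Proof. by case: z; case: w. Qed.
Lemma reN z : re (- z) = - re z. Proof. by case: z. Qed.
Lemma imN z : im (- z) = - im z. Proof. by case: z. Qed.
Lemma reM z w : re (z * w) = re z * re w - im z * im w.
Proof. by case: z; case: w. Qed.
Lemma imM z w : im (z * w) = re z * im w + im z * re w.
Proof. by case: z; case: w. Qed.
Lemma reJ z : re (conjc z) = re z. Proof. by case: z. Qed.
Lemma imJ z : im (conjc z) = - im z. Proof. by case: z. Qed.

Lemma re_sum (I : Type) (r : seq I) (P : pred I) (F : I -> R[i]) :
  re (\sum_(i <- r | P i) F i) = \sum_(i <- r | P i) re (F i).
Proof. by apply: (big_morph _ reD). Qed.

Lemma cabs_sqr z : cabs z ^+ 2 = re z ^+ 2 + im z ^+ 2.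
Proof.
by case: z => a b /=; rewrite sqr_sqrtr // addr_ge0 ?sqr_ge0.
Qed.

Lemma cabs_ge0 z : 0 <= cabs z. Proof. by case: z => a b; exact: sqrtr_ge0. Qed.

Lemma cabs_le0 z : cabs z <= 0 -> z = 0.
Proof.
by move=> h; apply: eq0_normc; apply/eqP; rewrite eq_le -/(cabs z) h cabs_ge0.
Qed.

Lemma cabs_normE z : `|z| = (cabs z)%:C.
Proof. by case: z => a b; rewrite normc_def. Qed.

Lemma cabs_real (r : R) : cabs r%:C = `|r|.
Proof. by rewrite /= expr0n /= addr0 sqrtr_sqr. Qed.

Lemma re_le_cabs z : `|re z| <= cabs z.
Proof.
rewrite -(ler_pXn2r (n := 2)) ?nnegrE ?cabs_ge0 // cabs_sqr real_normK ?num_real //.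
by rewrite lerDl sqr_ge0.
Qed.

Lemma im_le_cabs z : `|im z| <= cabs z.
Proof.
rewrite -(ler_pXn2r (n := 2)) ?nnegrE ?cabs_ge0 // cabs_sqr real_normK ?num_real //.
by rewrite lerDr sqr_ge0.
Qed.

Lemma ge0_complexE z : (0 <= z) = (im z == 0) && (0 <= re z).
Proof. by rewrite lecE /= eq_sym. Qed.

Definition cplxE := (reM, imM, reD, imD, reN, imN, reJ, imJ).

End ComplexScalars.

Section SemiInnerProduct.
Variables (R : realType) (L : lmodType R[i]).

Record semi_inner (f : L -> L -> R[i]) : Prop := SemiInner {
  semi_lin : forall z a x y, f z (a *: x + y) = a * f z x + f z y;
  semi_sym : forall x y, f x y = conjc (f y x);
  semi_ge0 : forall x, 0 <= re (f x x) }.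

Definition semi_norm (f : L -> L -> R[i]) x : R := Num.sqrt (re (f x x)).

Variable f : L -> L -> R[i].
Hypothesis sf : semi_inner f.

Lemma semiD z x y : f z (x + y) = f z x + f z y.
Proof. by have := semi_lin sf z 1 x y; rewrite scale1r mul1r. Qed.
Lemma semi0 z : f z 0 = 0.
Proof. by apply: (addrI (f z 0)); rewrite -semiD !addr0. Qed.
Lemma semiZ z a x : f z (a *: x) = a * f z x.
Proof. by have := semi_lin sf z a x 0; rewrite !addr0 semi0 addr0. Qed.
Lemma semiN z x : f z (- x) = - f z x.
Proof. by rewrite -scaleN1r semiZ mulN1r. Qed.
Lemma semiB z x y : f z (x - y) = f z x - f z y.
Proof. by rewrite semiD semiN. Qed.
Lemma semiDl z x y : f (x + y) z = f x z + f y z.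
Proof. by rewrite (semi_sym sf) semiD rmorphD /= -!(semi_sym sf). Qed.
Lemma semi0l z : f 0 z = 0.
Proof. by rewrite (semi_sym sf) semi0 conjc0. Qed.
Lemma semiZl z a x : f (a *: x) z = conjc a * f x z.
Proof. by rewrite (semi_sym sf) semiZ rmorphM /= -(semi_sym sf). Qed.
Lemma semiNl z x : f (- x) z = - f x z.
Proof. by rewrite (semi_sym sf) semiN rmorphN /= -(semi_sym sf). Qed.
Lemma semiBl z x y : f (x - y) z = f x z - f y z.
Proof. by rewrite semiDl semiNl. Qed.
Lemma semi_sumr (I : Type) (r : seq I) (P : pred I) (F : I -> L) z :
  f z (\sum_(i <- r | P i) F i) = \sum_(i <- r | P i) f z (F i).
Proof. exact: (big_morph _ (semiD z) (semi0 z)). Qed.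
Lemma semi_suml (I : Type) (r : seq I) (P : pred I) (F : I -> L) z :
  f (\sum_(i <- r | P i) F i) z = \sum_(i <- r | P i) f (F i) z.
Proof. exact: (big_morph _ (semiDl z) (semi0l z)). Qed.

Lemma semi_im0 x : im (f x x) = 0.
Proof.
have /(congr1 (@im R)) := semi_sym sf x x.
by rewrite imJ => /eqP; rewrite -addr_eq0 -mulr2n mulrn_eq0 /= => /eqP.
Qed.

Lemma semi_norm_ge0 x : 0 <= semi_norm f x. Proof. exact: sqrtr_ge0. Qed.

Lemma semi_norm_sqr x : semi_norm f x ^+ 2 = re (f x x).
Proof. by rewrite sqr_sqrtr // semi_ge0. Qed.

Lemma semi_selfE x : f x x = (semi_norm f x ^+ 2)%:C.
Proof. by rewrite semi_norm_sqr; apply: complex_eqP; rewrite //= semi_im0. Qed.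

Lemma re_semiC x y : re (f x y) = re (f y x).
Proof. by rewrite (semi_sym sf) reJ. Qed.

(** Expanding the square of [x - t <y, x> y] for every real [t] gives
    a quadratic in [t] that cannot become negative. *)
Lemma cauchy_schwarz x y : cabs (f x y) <= semi_norm f x * semi_norm f y.
Proof.
set s := cabs (f x y); set p := re (f x x); set q := re (f y y).
have H t : 0 <= p - 2 * t * s ^+ 2 + t ^+ 2 * s ^+ 2 * q.
  have := semi_ge0 sf (x - (t%:C * f y x) *: y).
  rewrite semiB !semiBl !semiZ !semiZl (semi_sym sf y x) rmorphM /= conjcK.
  rewrite !(cplxE R) /= semi_im0.
  rewrite -/p -/q /s cabs_sqr => h; apply: le_trans h _; rewrite le_eqVlt.
  by apply/orP; left; apply/eqP; ring.
have q0 : 0 <= q by exact: semi_ge0.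
have p0 : 0 <= p by exact: semi_ge0.
have s0 : 0 <= s by exact: cabs_ge0.
rewrite -(ler_pXn2r (n := 2)) ?nnegrE ?mulr_ge0 ?semi_norm_ge0 //.
rewrite exprMn !semi_norm_sqr -/p -/q.
move: q0; rewrite le_eqVlt => /orP[/eqP q0|q0].
  rewrite -q0 mulr0; case: (eqVneq (s ^+ 2) 0) => [->//|sn].
  have := H ((p + 1) / s ^+ 2); rewrite -q0 mulr0 addr0.
  by rewrite mulrA divfK // => h; lra.
have := H q^-1.
have -> : p - 2 * q^-1 * s ^+ 2 + q^-1 ^+ 2 * s ^+ 2 * q = p - s ^+ 2 / q.
  by field; lra.
by rewrite subr_ge0 ler_pdivrMr.
Qed.

Lemma semi_normZ a x : semi_norm f (a *: x) = cabs a * semi_norm f x.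
Proof.
apply/eqP; rewrite -(eqrXn2 (n := 2)) ?mulr_ge0 ?semi_norm_ge0 ?cabs_ge0 //.
apply/eqP; rewrite exprMn !semi_norm_sqr cabs_sqr semiZ semiZl !(cplxE R).
by rewrite semi_im0; ring.
Qed.

Lemma semi_normN x : semi_norm f (- x) = semi_norm f x.
Proof. by rewrite -scaleN1r semi_normZ -[X in cabs X](rmorphN1 (real_complex R)) cabs_real normrN1 mul1r. Qed.

Lemma semi_norm0 : semi_norm f 0 = 0.
Proof. by rewrite /semi_norm semi0 sqrtr0. Qed.

Lemma semi_normD x y : semi_norm f (x + y) <= semi_norm f x + semi_norm f y.
Proof.
rewrite -(ler_pXn2r (n := 2)) ?nnegrE ?addr_ge0 ?semi_norm_ge0 //.
rewrite sqrrD !semi_norm_sqr semiD !semiDl !reD (re_semiC y x).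
have h := le_trans (le_trans (ler_norm _) (re_le_cabs _)) (cauchy_schwarz x y).
by rewrite mulr2n; lra.
Qed.

Lemma semi_normB x y : semi_norm f (x - y) <= semi_norm f x + semi_norm f y.
Proof. by rewrite -(semi_normN y) semi_normD. Qed.

Lemma semi_norm_distC x y : semi_norm f (x - y) = semi_norm f (y - x).
Proof. by rewrite -semi_normN opprB. Qed.

Lemma semi_dist_triangle z x y :
  semi_norm f (x - y) <= semi_norm f (x - z) + semi_norm f (z - y).
Proof. by rewrite (le_trans _ (semi_normD _ _)) // addrA subrK. Qed.

Lemma semi_norm_sum (I : Type) (r : seq I) (P : pred I) (F : I -> L) :
  semi_norm f (\sum_(i <- r | P i) F i) <= \sum_(i <- r | P i) semi_norm f (F i).
Proof.
elim/big_rec2: _ => [|i y x _ h]; first by rewrite semi_norm0.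
by rewrite (le_trans (semi_normD _ _)) // lerD2l.
Qed.

End SemiInnerProduct.

(** * The Hilbert space of classes of a semi-inner product space *)

Section HilbertQuotient.
Local Open Scope quotient_scope.
Variables (R : realType) (L : lmodType R[i]).

(** Completeness, tested on sequences with a prescribed rate only; a Cauchy
    filter always contains balls from which such a sequence can be picked. *)
Definition fast_complete (f : L -> L -> R[i]) : Prop :=
  forall u : nat -> L,
    (forall i j, semi_norm f (u i - u j) <= i.+1%:R^-1 + j.+1%:R^-1) ->
  exists (l : L) (C : R), forall i, semi_norm f (u i - l) <= C / i.+1%:R.

Variable f : L -> L -> R[i].
Hypothesis sf : semi_inner f.
Hypothesis cf : fast_complete f.

Definition null_equiv (x y : L) := semi_norm f (x - y) == 0.

Lemma null_equiv_refl : reflexive null_equiv.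
Proof. by move=> x; rewrite /null_equiv subrr semi_norm0. Qed.
Lemma null_equiv_sym : symmetric null_equiv.
Proof. by move=> x y; rewrite /null_equiv semi_norm_distC. Qed.
Lemma null_equiv_trans : transitive null_equiv.
Proof.
move=> y x z /eqP xy /eqP yz; rewrite /null_equiv eq_le semi_norm_ge0 andbT.
by rewrite (le_trans (semi_dist_triangle sf y x z)) // xy yz addr0.
Qed.

Definition null_equivRel :=
  EquivRel null_equiv null_equiv_refl null_equiv_sym null_equiv_trans.

Definition hquot := {eq_quot null_equivRel}.
HB.instance Definition _ := Choice.on hquot.
HB.instance Definition _ := EqQuotient.on hquot.

Lemma hquotP (x y : L) :
  reflect (semi_norm f (x - y) = 0) (\pi_hquot x == \pi_hquot y).
Proof.
apply: (iffP idP) => [/eqP/eqquotP|h]; first by move/eqP.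
by apply/eqP/eqquotP; apply/eqP.
Qed.

Lemma hquot_eq (x y : L) : semi_norm f (x - y) = 0 -> \pi_hquot x = \pi_hquot y.
Proof. by move=> h; apply/eqP/hquotP. Qed.

Lemma hquot_repr (x : L) : semi_norm f (repr (\pi_hquot x) - x) = 0.
Proof. by apply/hquotP; rewrite reprK. Qed.

Definition hq0 : hquot := \pi_hquot 0.
(* The operations are locked: otherwise rewriting with [hqDE] would see a sum
   of classes as the class of a sum of representatives. *)
Definition hqN : hquot -> hquot := locked (fun x => \pi_hquot (- repr x)).
Definition hqD : hquot -> hquot -> hquot :=
  locked (fun x y => \pi_hquot (repr x + repr y)).
Definition hqZ : R[i] -> hquot -> hquot :=
  locked (fun a x => \pi_hquot (a *: repr x)).

Lemma hqNE x : hqN (\pi_hquot x) = \pi_hquot (- x).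
Proof.
rewrite /hqN -lock; apply: hquot_eq; rewrite opprK addrC (semi_norm_distC sf).
exact: hquot_repr.
Qed.

Lemma hqDE x y : hqD (\pi_hquot x) (\pi_hquot y) = \pi_hquot (x + y).
Proof.
rewrite /hqD -lock; apply: hquot_eq; apply/eqP; rewrite eq_le semi_norm_ge0 andbT opprD addrACA.
by rewrite (le_trans (semi_normD sf _ _)) // !hquot_repr addr0.
Qed.

Lemma hqZE a x : hqZ a (\pi_hquot x) = \pi_hquot (a *: x).
Proof. by rewrite /hqZ -lock; apply: hquot_eq; rewrite -scalerBr semi_normZ // hquot_repr mulr0. Qed.

Lemma hq_addA : associative hqD.
Proof.
elim/quotW=> x; elim/quotW=> y; elim/quotW=> z.
by rewrite !hqDE addrA.
Qed.
Lemma hq_addC : commutative hqD.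
Proof. by elim/quotW=> x; elim/quotW=> y; rewrite !hqDE addrC. Qed.
Lemma hq_add0 : left_id hq0 hqD.
Proof. by elim/quotW=> x; rewrite hqDE add0r. Qed.
Lemma hq_addN : left_inverse hq0 hqN hqD.
Proof. by elim/quotW=> x; rewrite hqNE hqDE addNr. Qed.
HB.instance Definition _ :=
  GRing.isZmodule.Build hquot hq_addA hq_addC hq_add0 hq_addN.

Lemma hq_scaleA a b v : hqZ a (hqZ b v) = hqZ (a * b) v.
Proof. by elim/quotW: v => x; rewrite !hqZE scalerA. Qed.
Lemma hq_scale1 : left_id 1 hqZ.
Proof. by elim/quotW=> x; rewrite hqZE scale1r. Qed.
Lemma hq_scaleDr : right_distributive hqZ +%R.
Proof. by move=> a; elim/quotW=> x; elim/quotW=> y; rewrite [LHS]/= [_ + _]hqDE !hqZE [RHS]hqDE scalerDr. Qed.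
Lemma hq_scaleDl v : {morph hqZ^~ v : a b / a + b}.
Proof. by elim/quotW: v => x a b; rewrite !hqZE [RHS]hqDE scalerDl. Qed.
HB.instance Definition _ := GRing.Zmodule_isLmodule.Build R[i] hquot
  hq_scaleA hq_scale1 hq_scaleDr hq_scaleDl.

Definition hq_class (x : L) : hquot := \pi_hquot x.

Lemma hq_class_linear : linear hq_class.
Proof. by move=> a x y; rewrite /hq_class -hqDE -hqZE. Qed.

Definition hq_form (x y : hquot) : R[i] := f (repr y) (repr x).

Lemma semi_null_r x y z : semi_norm f (x - y) = 0 -> f z x = f z y.
Proof.
move=> h; apply/eqP; rewrite -subr_eq0 -semiB //; apply/eqP.
by apply: cabs_le0; rewrite (le_trans (cauchy_schwarz sf z (x - y))) // h mulr0.
Qed.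

Lemma hq_formE x y : hq_form (hq_class x) (hq_class y) = f y x.
Proof.
rewrite /hq_form (semi_null_r _ (hquot_repr x)) (semi_sym sf).
by rewrite (semi_null_r _ (hquot_repr y)) -(semi_sym sf).
Qed.

Definition hq_norm (x : hquot) : R[i] := (semi_norm f (repr x))%:C.

Lemma hq_normE x : hq_norm (hq_class x) = (semi_norm f x)%:C.
Proof.
rewrite /hq_norm /semi_norm.
by rewrite [f (repr _) _](hq_formE x x).
Qed.

Lemma hq_normD x y : hq_norm (x + y) <= hq_norm x + hq_norm y.
Proof.
elim/quotW: x => x; elim/quotW: y => y; rewrite [_ + _]hqDE !hq_normE -rmorphD lecR.
exact: semi_normD.
Qed.
Lemma hq_normZ a x : hq_norm (a *: x) = `|a| * hq_norm x.
Proof.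
elim/quotW: x => x; rewrite [_ *: _]hqZE !hq_normE semi_normZ // cabs_normE.
by rewrite rmorphM.
Qed.
Lemma hq_norm_eq0 x : hq_norm x = 0 -> x = 0.
Proof.
elim/quotW: x => x; rewrite !hq_normE => -[h].
by apply: hquot_eq; rewrite subr0.
Qed.
HB.instance Definition _ := Lmodule_isNormed.Build R[i] hquot
  hq_normD hq_normZ hq_norm_eq0.

Lemma hquot_complete (F : set_system hquot) : ProperFilter F -> cauchy F -> cvg F.
Proof.
move=> FF Fc.
have ipos (i : nat) : (0 : R[i]) < ((i.+1%:R : R)^-1)%:C by rewrite ltcR invr_gt0 ltr0n.
have /choice[u Fu] : forall i : nat, exists x : L, F (ball (hq_class x) ((i.+1%:R : R)^-1)%:C).
  move=> i; have [x Fx] := (cauchyP F).1 Fc _ (ipos i).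
  by exists (repr x); rewrite /hq_class reprK.
have near_u i (y : hquot) : ball (hq_class (u i)) ((i.+1%:R : R)^-1)%:C y ->
    semi_norm f (u i - repr y) < i.+1%:R^-1.
  rewrite -ball_normE /ball_ /= -[y in `|_ - y|]reprK -[\pi _]/(hq_class _).
  have -> : hq_class (u i) - hq_class (repr y) = hq_class (u i - repr y).
    by rewrite [RHS]/hq_class -[RHS]hqDE -hqNE.
  by rewrite [X in X < _]hq_normE ltcR.
have [i j|l [C ul]] := cf (u := u).
  have [y [/near_u hi /near_u hj]] := @filter_ex _ _ FF _ (filterI (Fu i) (Fu j)).
  rewrite (le_trans (semi_dist_triangle sf (repr y) _ _)) // lerD ?(ltW hi) //.
  by rewrite semi_norm_distC // ltW.
apply/cvg_ex; exists (hq_class l); apply/cvgrPdist_lt => /= e e0.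
have eE : e = (re e)%:C.
  by move: e0; rewrite ltcE /= => /andP[/eqP e0 _]; apply: complex_eqP.
have ree0 : 0 < re e by move: e0; rewrite eE ltcR.
have [k hk] : exists k : nat, (C + 1) / k.+1%:R < re e.
  exists (Num.truncn ((C + 1) / re e)); rewrite ltr_pdivrMr ?ltr0n // mulrC -ltr_pdivrMr //.
  exact: truncnS_gt.
apply: filterS (Fu k) => y /near_u h.
rewrite -[y]reprK -[\pi _]/(hq_class _) eE.
have -> : hq_class l - hq_class (repr y) = hq_class (l - repr y).
  by rewrite [RHS]/hq_class -[RHS]hqDE -hqNE.
rewrite [X in X < _]hq_normE ltcR (le_lt_trans _ hk) //.
rewrite (le_trans (semi_dist_triangle sf (u k) _ _)) // mulrDl mul1r lerD ?(ltW h) //.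
by rewrite (semi_norm_distC sf) ul.
Qed.

HB.instance Definition _ := Uniform_isComplete.Build hquot hquot_complete.

Lemma hq_form_bilinear : bilinear_for ( *%R ) (Num.conj \; *%R) hq_form.
Proof.
split=> u a x y; elim/quotW: u => u; elim/quotW: x => x; elim/quotW: y => y.
  by rewrite -!/(hq_class _) -hq_class_linear !hq_formE (semi_lin sf).
rewrite -!/(hq_class _) -hq_class_linear !hq_formE semiDl // semiZl //.
Qed.
HB.instance Definition _ := bilinear_isBilinear.Build R[i] hquot hquot R[i]
  ( *%R ) (Num.conj \; *%R) hq_form hq_form_bilinear.

Lemma hq_form_sym x y : hq_form x y = (-1) ^+ false * Num.conj (hq_form y x).
Proof. by rewrite expr0 mul1r /hq_form (semi_sym sf). Qed.
HB.instance Definition _ := isHermitianSesquilinear.Build R[i] hquot false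
  Num.conj hq_form hq_form_sym.

Lemma hq_form_normE x : hq_form x x = hq_norm x ^+ 2.
Proof. by rewrite /hq_form /hq_norm -rmorphXn (semi_selfE sf). Qed.

Lemma hq_form_gt0 x : x != 0 -> 0 < hq_form x x.
Proof.
move=> x0; rewrite hq_form_normE exprn_gt0 // lt_def.
rewrite [X in _ && X](_ : _ = true) ?andbT; last by rewrite lecR semi_norm_ge0.
by apply: contraNneq x0 => /hq_norm_eq0 ->.
Qed.
HB.instance Definition _ := isDotProduct.Build R[i] hquot hq_form hq_form_gt0.

Definition hilbert_quot : hilbertType R :=
  @Hilbert R hquot hq_form hq_form_normE.

Definition hilbert_class (x : L) : hilbert_quot := hq_class x.

End HilbertQuotient.

(** The single source of Hilbert spaces below: ranges of projections, direct sums
    and ultraproducts all arise from a semi-inner product on a module at hand. *)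
Lemma hilbert_quotient (R : realType) (L : lmodType R[i]) (f : L -> L -> R[i]) :
    semi_inner f -> fast_complete f ->
  exists (H : hilbertType R) (q : L -> H),
    [/\ linear q, forall h, exists x, q x = h &
        forall x y, inner (q x) (q y) = f x y].
Proof.
move=> sf cf; exists (hilbert_quot sf cf), (@hilbert_class _ _ _ sf cf).
split; first exact: hq_class_linear.
- by move=> h; exists (repr (h : hquot sf)); rewrite /hilbert_class /hq_class reprK.
- by move=> x y; rewrite /inner /= hq_formE.
Qed.

(** * Operators on a Hilbert space *)

Section Linear.
Variables (R : realType) (L L' : lmodType R[i]) (T : L -> L').
Hypothesis lT : linear T.
Lemma linD x y : T (x + y) = T x + T y.
Proof. by have := lT 1 x y; rewrite !scale1r. Qed.
Lemma lin0 : T 0 = 0.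
Proof. by apply: (addrI (T 0)); rewrite -linD !addr0. Qed.
Lemma linZ a x : T (a *: x) = a *: T x.
Proof. by have := lT a x 0; rewrite lin0 !addr0. Qed.
Lemma linN x : T (- x) = - T x.
Proof. by rewrite -scaleN1r linZ scaleN1r. Qed.
Lemma linB x y : T (x - y) = T x - T y.
Proof. by rewrite linD linN. Qed.
Lemma lin_sum (I : Type) (r : seq I) (P : pred I) (F : I -> L) :
  T (\sum_(i <- r | P i) F i) = \sum_(i <- r | P i) T (F i).
Proof. exact: (big_morph _ linD lin0). Qed.
End Linear.

Section HilbertBasics.
Variables (R : realType) (H : hilbertType R).
Implicit Types (S T B : H -> H) (x y z : H).

Definition nrm x : R := semi_norm (@inner R H) x.

Lemma inner_normE x : inner x x = `|x| ^+ 2.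
Proof. by rewrite /inner hilbert_normE. Qed.

Lemma inner_semi : semi_inner (@inner R H).
Proof.
split=> [z a x y|x y|x].
- by rewrite /inner linearDl linearZl_LR.
- have := @hermitian_subproof _ _ _ _ (hilbert_form H) y x.
  by rewrite expr0 mul1r.
- rewrite inner_normE; have : 0 <= `|x| ^+ 2 by rewrite exprn_ge0.
  by rewrite ge0_complexE => /andP[].
Qed.
Local Notation isem := inner_semi.

Lemma norm_nrmE x : `|x| = (nrm x)%:C.
Proof.
apply/eqP; rewrite -(eqrXn2 (n := 2)) ?normr_ge0 ?lecR ?semi_norm_ge0 //.
by rewrite -inner_normE -rmorphXn (semi_selfE isem).
Qed.

Lemma nrm_ge0 x : 0 <= nrm x. Proof. exact: semi_norm_ge0. Qed.
Lemma nrm0 : nrm 0 = 0. Proof. exact: semi_norm0 isem. Qed.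
Lemma nrm_le0 x : nrm x <= 0 -> x = 0.
Proof.
move=> h; apply/eqP; rewrite -normr_eq0 norm_nrmE.
by rewrite (_ : nrm x = 0) //; apply/eqP; rewrite eq_le h nrm_ge0.
Qed.
Lemma nrmN x : nrm (- x) = nrm x. Proof. exact: semi_normN isem _. Qed.
Lemma nrmD x y : nrm (x + y) <= nrm x + nrm y. Proof. exact: semi_normD isem _ _. Qed.
Lemma nrmB x y : nrm (x - y) <= nrm x + nrm y. Proof. exact: semi_normB isem _ _. Qed.
Lemma nrmZ a x : nrm (a *: x) = cabs a * nrm x. Proof. exact: semi_normZ isem _ _. Qed.
Lemma nrm_distC x y : nrm (x - y) = nrm (y - x).
Proof. exact: semi_norm_distC isem _ _. Qed.
Lemma nrm_dist_triangle z x y : nrm (x - y) <= nrm (x - z) + nrm (z - y).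
Proof. exact: semi_dist_triangle isem _ _ _. Qed.
Lemma nrm_sum (I : Type) (r : seq I) (P : pred I) (F : I -> H) :
  nrm (\sum_(i <- r | P i) F i) <= \sum_(i <- r | P i) nrm (F i).
Proof. exact: (semi_norm_sum isem). Qed.
Lemma nrm_sqr x : nrm x ^+ 2 = re (inner x x). Proof. exact: semi_norm_sqr isem _. Qed.
Lemma inner_selfE x : inner x x = (nrm x ^+ 2)%:C. Proof. exact: semi_selfE isem _. Qed.
Lemma innerC x y : inner x y = conjc (inner y x). Proof. exact: semi_sym isem _ _. Qed.
Lemma inner_le x y : cabs (inner x y) <= nrm x * nrm y.
Proof. exact: cauchy_schwarz isem _ _. Qed.

(** All limits below come with a rate, and are used by letting the error term
    [C / k.+1] drop out. *)
Lemma arch_le (a b C : R) : (forall k : nat, a <= b + C / k.+1%:R) -> a <= b.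
Proof.
move=> h; rewrite leNgt; apply/negP => ba.
have d0 : 0 < a - b by rewrite subr_gt0.
pose k := Num.truncn (`|C| / (a - b)).
have hk : `|C| / (a - b) < k.+1%:R by exact: truncnS_gt.
have : C / k.+1%:R < a - b.
  rewrite ltr_pdivrMr ?ltr0n // mulrC; apply: le_lt_trans (ler_norm C) _.
  by rewrite -ltr_pdivrMr.
by have := h k; rewrite -lerBlDl => h1 h2; have := le_lt_trans h1 h2; rewrite ltxx.
Qed.

Lemma nrm_arch0 x (C : R) : (forall k : nat, nrm x <= C / k.+1%:R) -> x = 0.
Proof. by move=> h; apply: nrm_le0; apply: (@arch_le _ _ C) => k; rewrite add0r. Qed.

Lemma hilbert_fast_cvg (u : nat -> H) (C : R) :
    (forall i j, nrm (u i - u j) <= C * (i.+1%:R^-1 + j.+1%:R^-1)) ->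
  exists l, forall i, nrm (u i - l) <= C / i.+1%:R.
Proof.
move=> uC.
have cu : cauchy (u @ \oo).
  apply/cauchyP => e e0.
  have eE : e = (re e)%:C.
    by move: e0; rewrite ltcE /= => /andP[/eqP e0 _]; apply: complex_eqP.
  have ree0 : 0 < re e by move: e0; rewrite eE ltcR.
  have C0 : 0 <= C.
    have := le_trans (nrm_ge0 _) (uC 0%N 0%N).
    by rewrite pmulr_lge0 // addr_gt0 ?invr_gt0 ?ltr0n.
  pose k := Num.truncn (2 * C / re e).
  exists (u k); exists k => // i /= ki; rewrite -ball_normE /ball_ /= norm_nrmE eE ltcR.
  apply: (le_lt_trans (uC k i)).
  apply: (@le_lt_trans _ _ (2 * C / k.+1%:R)).
    rewrite (mulrC 2) -mulrA ler_wpM2l // mulr_natl mulr2n lerD2l.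
    by rewrite lef_pV2 ?posrE ?ltr0n // ler_nat.
  rewrite ltr_pdivrMr ?ltr0n // [ltRHS]mulrC -ltr_pdivrMr //; exact: truncnS_gt.
have /cvg_ex[l ul] : cvg (u @ \oo) by exact: cauchy_cvg.
exists l => i; apply: (@arch_le _ _ (C + 1)) => k.
have k0 : (0 : R[i]) < (k.+1%:R^-1 : R)%:C by rewrite ltcR invr_gt0 ltr0n.
move/cvgrPdist_lt: ul => /(_ _ k0) [N _ hN].
have := hN (maxn N k) (leq_maxl _ _); rewrite /= norm_nrmE ltcR => h.
rewrite (le_trans (nrm_dist_triangle (u (maxn N k)) _ _)) //.
rewrite mulrDl mul1r addrA; apply: lerD; last by rewrite nrm_distC ltW.
rewrite (le_trans (uC _ _)) // mulrDr lerD2l.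
have C0 : 0 <= C.
  have := le_trans (nrm_ge0 _) (uC 0%N 0%N).
  by rewrite pmulr_lge0 // addr_gt0 ?invr_gt0 ?ltr0n.
by rewrite ler_wpM2l // lef_pV2 ?posrE ?ltr0n // ler_nat ltnS leq_maxr.
Qed.

Lemma lin_comp S T : linear S -> linear T -> linear (S \o T).
Proof. by move=> lS lT a x y /=; rewrite lT lS. Qed.
Lemma lin_add S T : linear S -> linear T -> linear (fun x => S x + T x).
Proof. by move=> lS lT a x y /=; rewrite lT lS scalerDr addrACA. Qed.
Lemma lin_sub S T : linear S -> linear T -> linear (fun x => S x - T x).
Proof. by move=> lS lT a x y /=; rewrite lT lS scalerBr opprD addrACA. Qed.
Lemma lin_scale a T : linear T -> linear (fun x => a *: T x).
Proof. by move=> lT b x y /=; rewrite lT scalerDr !scalerA mulrC. Qed.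
Lemma lin_bigsum (I : Type) (r : seq I) (P : pred I) (F : I -> H -> H) :
  (forall i, linear (F i)) -> linear (fun x => \sum_(i <- r | P i) F i x).
Proof.
move=> lF a x y; rewrite scaler_sumr -big_split /=.
by apply: eq_bigr => i _; rewrite lF.
Qed.

Definition obnd T (M : R) := forall x, nrm (T x) <= M * nrm x.
Definition contr T := forall x, nrm (T x) <= nrm x.
(** The commutator has operator norm at most [e]. Stated for vectors, the bound
    composes along sums and products of operators ([comm_add], [comm_comp]). *)
Definition comm_le S T (e : R) := forall x, nrm (S (T x) - T (S x)) <= e * nrm x.
Definition selfadj T := forall x y, inner (T x) y = inner x (T y).

Lemma bounded_opP T : bounded_op T <-> linear T /\ exists2 M : R, 0 <= M & obnd T M.
Proof.
split=> [[lT [M hM]]|[lT [M M0 hM]]]; split => //.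
  exists `|re M| => // x; have := hM x; rewrite !norm_nrmE lecE => /andP[_].
  rewrite -!/(re _) reM /= mulr0 subr0 => /le_trans; apply.
  by rewrite ler_wpM2r ?nrm_ge0 // ler_norm.
by exists M%:C => x; rewrite !norm_nrmE -rmorphM lecR.
Qed.

Lemma contr_bounded T : linear T -> contr T -> bounded_op T.
Proof. by move=> lT cT; apply/bounded_opP; split => //; exists 1 => // x; rewrite mul1r. Qed.

Lemma opnorm_le T (e : R) : 0 <= e -> obnd T e -> opnorm T <= e.
Proof.
move=> e0 hT; rewrite /opnorm; apply: ge_sup.
  exists (complex.Re `|T 0|); exists 0 => //=.
  by rewrite normr0 ler01.
move=> _ [x /= x1 <-]; rewrite norm_nrmE /=; apply: (le_trans (hT x)).
by rewrite ler_piMr //; move: x1; rewrite norm_nrmE lecR.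
Qed.

Lemma opnorm_obnd T : bounded_op T -> obnd T (opnorm T).
Proof.
move=> /bounded_opP[lT [M M0 hM]] x.
have [->|x0] := eqVneq x 0; first by rewrite lin0 // nrm0 mulr0.
have nx : 0 < nrm x.
  by rewrite lt_def nrm_ge0 andbT; apply: contraNneq x0 => h; rewrite (@nrm_le0 x) // h.
rewrite -ler_pdivrMr //.
have -> : nrm (T x) / nrm x = complex.Re `|T ((nrm x)^-1%:C *: x)|.
  rewrite norm_nrmE /= linZ // nrmZ cabs_real ?ger0_norm ?invr_ge0 ?nrm_ge0 //.
  by rewrite mulrC.
apply: ub_le_sup.
  exists M => _ [y /= y1 <-]; rewrite norm_nrmE /=; apply: (le_trans (hM y)).
  by rewrite ler_piMr //; move: y1; rewrite norm_nrmE lecR.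
exists ((nrm x)^-1%:C *: x) => //=.
rewrite norm_nrmE nrmZ cabs_real ger0_norm ?invr_ge0 ?nrm_ge0 // mulVf ?lecR //.
by rewrite gt_eqF.
Qed.

Lemma psd_lin T : psd T -> linear T. Proof. by case=> -[]. Qed.
Lemma psd_re T x : psd T -> 0 <= re (inner x (T x)).
Proof. by move=> [_ /(_ x)]; rewrite ge0_complexE => /andP[]. Qed.

(** Polarization: a quadratic form with real values on the complex space [H]
    is Hermitian. *)
Lemma psd_selfadj T : psd T -> selfadj T.
Proof.
move=> pT; have lT := psd_lin pT.
have im0 x : im (inner x (T x)) = 0.
  by case: pT => _ /(_ x); rewrite ge0_complexE => /andP[/eqP].
move=> x y; rewrite innerC.
have h1 := im0 (x + y); have h2 := im0 (x + 'i *: y).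
move: h1 h2; rewrite !(linD lT) !(linZ lT).
rewrite !(semiD isem) !(semiDl isem) !(semiZ isem) !(semiZl isem) !(cplxE R) /= !im0.
move=> h1 h2.
by apply: complex_eqP; rewrite !(cplxE R); lra.
Qed.

Lemma psd_intro T : linear T -> (exists2 M : R, 0 <= M & obnd T M) -> selfadj T ->
  (forall x, 0 <= re (inner x (T x))) -> psd T.
Proof.
move=> lT bT sT pT; split; first by apply/bounded_opP.
move=> x; rewrite ge0_complexE pT andbT -sT.
have /(congr1 (@im R)) := innerC x (T x); rewrite sT (cplxE R).
by move=> h; apply/eqP; lra.
Qed.

Lemma psd_semi T : psd T -> semi_inner (fun x y => inner x (T y)).
Proof.
move=> pT; split=> [z a x y|x y|x]; last exact: psd_re.
  by rewrite (psd_lin pT) (semi_lin isem).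
by rewrite -(psd_selfadj pT) innerC.
Qed.

(** Cauchy-Schwarz for the form [<x, T y>]. *)
Lemma psd_form0 T x : psd T -> re (inner x (T x)) = 0 -> T x = 0.
Proof.
move=> pT h; have := cauchy_schwarz (psd_semi pT) (T x) x.
rewrite [X in _ * X]/semi_norm h sqrtr0 mulr0 inner_selfE cabs_real.
rewrite ger0_norm ?sqr_ge0 // => h0; apply: nrm_le0.
by rewrite -(ler_pXn2r (n := 2)) ?nnegrE ?nrm_ge0 // expr0n.
Qed.

(** Cauchy-Schwarz for the form [<x, T y>] bounds [|T x|^2 = <T x, T x>] by
    [|T x| |x|]. *)
Lemma psd_contr T : psd T -> (forall x, re (inner x (T x)) <= nrm x ^+ 2) -> contr T.
Proof.
move=> pT hT x; have := cauchy_schwarz (psd_semi pT) (T x) x.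
rewrite inner_selfE cabs_real ger0_norm ?sqr_ge0 // => h.
have bd y : semi_norm (fun x y => inner x (T y)) y <= nrm y.
  rewrite -(ler_pXn2r (n := 2)) ?nnegrE ?nrm_ge0 ?semi_norm_ge0 //.
  by rewrite (semi_norm_sqr (psd_semi pT)).
have {}h : nrm (T x) ^+ 2 <= nrm (T x) * nrm x.
  by apply: (le_trans h); rewrite ler_pM ?semi_norm_ge0.
have := nrm_ge0 (T x); rewrite le_eqVlt => /orP[/eqP<-|p]; first exact: nrm_ge0.
by move: h; rewrite expr2 ler_pM2l.
Qed.

Lemma selfadj_idem_contr T : selfadj T -> (forall x, T (T x) = T x) -> contr T.
Proof.
move=> sT iT x; have h : nrm (T x) ^+ 2 <= nrm (T x) * nrm x.
  rewrite nrm_sqr sT iT -sT; apply: le_trans (inner_le _ _).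
  exact: le_trans (ler_norm _) (re_le_cabs _).
have := nrm_ge0 (T x); rewrite le_eqVlt => /orP[/eqP<-|p]; first exact: nrm_ge0.
by move: h; rewrite expr2 ler_pM2l.
Qed.

Section POVM.
Variables (m : nat) (A : 'I_m -> H -> H).
Hypothesis pA : povm A.

Lemma povm_psd k : psd (A k). Proof. by case: pA. Qed.
Lemma povm_lin k : linear (A k). Proof. exact/psd_lin/povm_psd. Qed.
Lemma povm_le1 k x : re (inner x (A k x)) <= nrm x ^+ 2.
Proof.
rewrite nrm_sqr -{4}(pA.2 x) (semi_sumr isem) re_sum (bigD1 k) //= lerDl.
by rewrite sumr_ge0 // => j _; exact/psd_re/povm_psd.
Qed.
Lemma povm_contr k : contr (A k).
Proof. by apply: psd_contr (povm_psd k) _ => x; exact: povm_le1. Qed.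
End POVM.

End HilbertBasics.

(** * Square roots and their commutators *)

Section SquareRoot.
Variables (R : realType) (H : hilbertType R).
Implicit Types (S T B : H -> H) (x y z : H).

(** Iteration for a fixed point of [Y = (X + Y^2) / 2], that is,
    of [(1 - Y)^2 = 1 - X]. *)
Fixpoint sqrt_iter (X : H -> H) (k : nat) : H -> H :=
  if k is k'.+1 then fun x => 2^-1 *: (X x + sqrt_iter X k' (sqrt_iter X k' x))
  else fun=> 0.

(** The same iteration for the scalar [X = 1]; it dominates the operator one and
    tends to [1]. *)
Fixpoint sqrt_bound (k : nat) : R :=
  if k is k'.+1 then 2^-1 * (1 + sqrt_bound k' ^+ 2) else 0.

Lemma sqrt_bound_ge0 k : 0 <= sqrt_bound k.
Proof. by case: k => //= k; rewrite mulr_ge0 ?invr_ge0 ?addr_ge0 ?sqr_ge0. Qed.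

(** The defect [z = 1 - sqrt_bound k] follows the recursion [z := z - z^2 / 2]. *)
Lemma sqrt_bound_defect k : 0 <= 1 - sqrt_bound k <= 2 / k.+2%:R.
Proof.
elim: k => [|k /andP[h0 h1]] /=; first by rewrite subr0 ler01 /= divff ?pnatr_eq0 ?lexx.
have y0 := sqrt_bound_ge0 k; set t := sqrt_bound k in h0 h1 y0 *.
apply/andP; split; first by nra.
have p3 : (0 : R) < k.+3%:R by rewrite ltr0n.
have p2 : (0 : R) < k.+2%:R by rewrite ltr0n.
rewrite ler_pdivlMr //; rewrite ler_pdivlMr // in h1.
have e3 : (k.+3%:R : R) = k.+2%:R + 1 by rewrite -natr1.
have q2 : (2 : R) <= k.+2%:R by rewrite ler_nat.
(* With [z := 1 - t] and [w := 1 / n] this is [(z - z^2 / 2) (n + 1) <= 2]: the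
   left side increases with [z <= 2 w], as the product below expresses. *)
rewrite e3; move: h0 h1 y0 p2 q2; set n := k.+2%:R : R => h0 h1 y0 p2 q2.
have [z ze] : exists z : R, z = 1 - t by exists (1 - t).
have -> : t = 1 - z by rewrite ze; ring.
rewrite -ze in h0 h1; have z1 : z <= 1 by rewrite ze; lra.
have [w we] : exists w : R, w = n^-1 by exists n^-1.
have n0 : n != 0 by rewrite gt_eqF.
have zn2 : z <= 2 * w by rewrite we ler_pdivlMr.
have w2 : w <= 2^-1 by rewrite we lef_pV2 ?posrE.
have znw : z * n * w = z by rewrite we mulfK.
have wn : n * w = 1 by rewrite we divff.
have : 0 <= (2 - z * n) * (1 - z / 2 - w).
  by apply: mulr_ge0; [rewrite subr_ge0|lra].
have -> : (2 - z * n) * (1 - z / 2 - w) =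
  2 - z - 2 * w - z * n + z ^+ 2 * n / 2 + z * n * w by field.
rewrite znw => h; have := sqr_ge0 z.
have -> : (1 - 2^-1 * (1 + (1 - z) ^+ 2)) * (n + 1) =
  z * n - z ^+ 2 * n / 2 + z - z ^+ 2 / 2 by field.
lra.
Qed.

Section Iteration.
Variable X : H -> H.
Hypotheses (lX : linear X) (cX : contr X).
Local Notation Y := (sqrt_iter X).
Local Notation y := sqrt_bound.

Lemma sqrt_iter_lin k : linear (Y k).
Proof.
elim: k => [|k lY] /=; first by move=> a u v; rewrite scaler0 addr0.
by apply: lin_scale; apply: lin_add => //; apply: (lin_comp (S := Y k)).
Qed.

Lemma cabs_half : cabs (2^-1 : R[i]) = 2^-1.
Proof.
have -> : (2^-1 : R[i]) = (2^-1 : R)%:C by rewrite fmorphV rmorph_nat.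
by rewrite cabs_real ger0_norm // invr_ge0.
Qed.

Lemma sqrt_iter_bnd k : obnd (Y k) (y k).
Proof.
elim: k => [|k bY] x /=; first by rewrite nrm0 mul0r.
rewrite nrmZ cabs_half -mulrA ler_wpM2l ?invr_ge0 // (le_trans (nrmD _ _)) //.
rewrite mulrDl mul1r lerD // (le_trans (bY _)) // expr2 -mulrA.
by rewrite ler_wpM2l ?sqrt_bound_ge0.
Qed.

(** [a^2 - b^2 = a (a - b) + (a - b) b], whose norm is bounded term by term by the
    scalar iteration. *)
Lemma sqrt_iter_step k x : nrm (Y k.+1 x - Y k x) <= (y k.+1 - y k) * nrm x.
Proof.
elim: k x => [|k IH] x.
  by have := sqrt_iter_bnd 1 x; rewrite [Y 0 x]/= [y 0]/= !subr0.
set a := Y k.+1; set b := Y k.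
have -> : Y k.+2 x - Y k.+1 x = 2^-1 *: (a (a x - b x) + (a (b x) - b (b x))).
  rewrite /a /b (linB (sqrt_iter_lin k.+1)) addrA subrK.
  by rewrite -[X in X - _ = _]/(2^-1 *: (X x + a (a x))) -scalerBr opprD addrACA subrr add0r.
have -> : y k.+2 - y k.+1 = 2^-1 * (y k.+1 * (y k.+1 - y k) + (y k.+1 - y k) * y k).
  by rewrite -[y k.+2]/(2^-1 * (1 + y k.+1 ^+ 2)) [in X in _ - X = _]/=; field.
rewrite nrmZ cabs_half -mulrA ler_wpM2l ?invr_ge0 // (le_trans (nrmD _ _)) //.
have y0 j := sqrt_bound_ge0 j.
have dy : 0 <= y k.+1 - y k by rewrite /=; have := sqr_ge0 (1 - y k); lra.
rewrite mulrDl lerD //.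
  by rewrite (le_trans (sqrt_iter_bnd _ _)) // -mulrA ler_wpM2l.
by rewrite (le_trans (IH _)) // -mulrA ler_wpM2l // sqrt_iter_bnd.
Qed.

Lemma sqrt_iter_dist j k x : (j <= k)%N ->
  nrm (Y k x - Y j x) <= (y k - y j) * nrm x.
Proof.
move=> /subnK <-; elim: (k - j)%N => [|n IH]; first by rewrite add0n !subrr nrm0 mul0r.
rewrite addSn (le_trans (nrm_dist_triangle (Y (n + j) x) _ _)) //.
apply: (le_trans (lerD (sqrt_iter_step _ _) IH)).
by rewrite -mulrDl addrA subrK.
Qed.

(** The increments are dominated by those of the increasing scalar sequence,
    whose sum telescopes. *)
Lemma sqrt_iter_limit : exists Z : H -> H, forall x k,
  nrm (Y k x - Z x) <= 2 * nrm x / k.+1%:R.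
Proof.
suff /choice[Z hZ] : forall x, exists l, forall k,
  nrm (Y k x - l) <= 2 * nrm x / k.+1%:R by exists Z.
move=> x; apply: hilbert_fast_cvg => i j.
wlog ij : i j / (i <= j)%N.
  move=> W; case/orP: (leq_total i j) => [/W//|/W].
  by rewrite nrm_distC [X in _ * X]addrC.
rewrite nrm_distC (le_trans (sqrt_iter_dist _ ij)) //.
rewrite [leRHS]mulrAC ler_wpM2r ?nrm_ge0 //.
have /andP[_ hi] := sqrt_bound_defect i; have /andP[hj _] := sqrt_bound_defect j.
apply: (@le_trans _ _ (2 / i.+2%:R)); first by rewrite (le_trans _ hi) // lerD2r -subr_ge0.
rewrite ler_wpM2l // (@le_trans _ _ i.+1%:R^-1) //.
  by rewrite lef_pV2 ?posrE ?ltr0n // ler_nat.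
by rewrite lerDl invr_ge0 ler0n.
Qed.

End Iteration.

Lemma comm_comp S S' T (M M' e e' : R) : linear S -> obnd S M -> obnd S' M' -> 0 <= M -> 0 <= e ->
  comm_le S T e -> comm_le S' T e' -> comm_le (S \o S') T (e * M' + M * e').
Proof.
move=> lS bS bS' M0 e0 c c' x /=.
rewrite (le_trans (nrm_dist_triangle (S (T (S' x))) _ _)) // addrC mulrDl lerD //.
  by rewrite (le_trans (c _)) // -mulrA ler_wpM2l.
by rewrite -(linB lS) (le_trans (bS _)) // -mulrA ler_wpM2l.
Qed.

Lemma comm_add S S' T e e' : linear T -> comm_le S T e -> comm_le S' T e' ->
  comm_le (fun x => S x + S' x) T (e + e').
Proof.
move=> lT c c' x; rewrite (linD lT) opprD addrACA mulrDl.
by rewrite (le_trans (nrmD _ _)) // lerD.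
Qed.

Lemma comm_scale a S T e : linear T -> comm_le S T e ->
  comm_le (fun x => a *: S x) T (cabs a * e).
Proof.
move=> lT c x; rewrite (linZ lT) -scalerBr nrmZ -mulrA.
by rewrite ler_wpM2l // cabs_ge0.
Qed.

Lemma comm_sym S T e : comm_le S T e -> comm_le T S e.
Proof. by move=> c x; rewrite nrm_distC. Qed.

(** Each step adds to the commutator half the commutator of [X] and averages
    two copies of the previous commutator, as the iterates are contractions. *)
Lemma sqrt_iter_comm X B k (e : R) : linear X -> contr X -> linear B -> 0 <= e ->
  comm_le X B e -> comm_le (sqrt_iter X k) B (k%:R / 2 * e).
Proof.
move=> lX cX lB e0 c; elim: k => [|k IH].
  by move=> x /=; rewrite (lin0 lB) subrr nrm0 !mul0r.
have b1 : obnd (sqrt_iter X k) 1.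
  move=> x; rewrite (le_trans (sqrt_iter_bnd cX k x)) // ler_wpM2r ?nrm_ge0 //.
  by have /andP[] := sqrt_bound_defect k; rewrite subr_ge0.
have lY := sqrt_iter_lin lX k.
have ke : 0 <= k%:R / 2 * e by rewrite !mulr_ge0 ?invr_ge0.
have := comm_scale 2^-1 lB (comm_add lB c (comm_comp lY b1 b1 ler01 ke IH IH)).
rewrite cabs_half.
have -> // : 2^-1 * (e + (k%:R / 2 * e * 1 + 1 * (k%:R / 2 * e))) = k.+1%:R / 2 * e.
by rewrite -natr1; field.
Qed.

(** [0 <= T <= 1]. *)
Definition effect T := psd T /\ forall x, re (inner x (T x)) <= nrm x ^+ 2.

Lemma comm_id_sub T B e : linear B -> comm_le T B e -> comm_le (fun x => x - T x) B e.
Proof.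
move=> lB c x; rewrite (linB lB) opprD addrACA subrr add0r opprK addrC nrm_distC.
exact: c.
Qed.

(** The root is [1 - Z] for the limit [Z] of the iteration with [X := 1 - T]. For
    the commutator, [Z] is replaced by the [k]-th iterate at the cost of
    [2 / k.+1] on each side of [B]. *)
Lemma sqrt_exists T : effect T -> exists S, [/\ psd S, forall x, S (S x) = T x &
  forall B M e, linear B -> obnd B M -> 0 <= M -> 0 <= e -> comm_le T B e ->
    forall k, comm_le S B (k%:R / 2 * e + 4 * M / k.+1%:R)].
Proof.
move=> [pT T1]; have lT := psd_lin pT; have sT := psd_selfadj pT.
pose X x := x - T x.
have lX : linear X by apply: lin_sub lT => //.
have sX : selfadj X.
  by move=> x z; rewrite /X (semiBl (@inner_semi _ H)) (semiB (@inner_semi _ H)) sT.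
have pX : psd X.
  apply: psd_intro => //.
    have [_ [M M0 bT]] := (bounded_opP T).1 pT.1.
    exists (1 + M); first by rewrite addr_ge0.
    by move=> x; rewrite (le_trans (nrmB _ _)) // mulrDl mul1r lerD2l.
  move=> x; rewrite (semiB (@inner_semi _ H)) reD reN subr_ge0 -nrm_sqr.
  exact: T1.
have cX : contr X.
  apply: psd_contr => // x.
  rewrite (semiB (@inner_semi _ H)) reD reN -nrm_sqr gerBl.
  exact: psd_re.
have [Z hZ] := sqrt_iter_limit lX cX.
have lY := sqrt_iter_lin lX.
have YZ x k : nrm (Z x - sqrt_iter X k x) <= 2 * nrm x / k.+1%:R by rewrite nrm_distC.
have bY k : contr (sqrt_iter X k).
  move=> x; rewrite (le_trans (sqrt_iter_bnd cX k x)) // ler_piMl ?nrm_ge0 //.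
  by have /andP[] := sqrt_bound_defect k; rewrite subr_ge0.
have cZ : contr Z.
  move=> x; apply: (@arch_le _ _ _ (2 * nrm x)) => k.
  rewrite -[Z x](subrK (sqrt_iter X k x)) addrC (le_trans (nrmD _ _)) // lerD //.
  exact: bY.
have lZ : linear Z.
  move=> a u v; apply/eqP; rewrite -subr_eq0; apply/eqP.
  apply: (@nrm_arch0 _ _ _ (2 * nrm (a *: u + v) + (cabs a * (2 * nrm u) + 2 * nrm v))) => k.
  rewrite (le_trans (nrm_dist_triangle (sqrt_iter X k (a *: u + v)) _ _)) // mulrDl lerD //.
  rewrite lY opprD addrACA -scalerBr (le_trans (nrmD _ _)) // mulrDl lerD // nrmZ -mulrA.
  by rewrite ler_wpM2l ?cabs_ge0.
have sY k : selfadj (sqrt_iter X k).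
  elim: k => [|k IH] x z /=; first by rewrite (semi0 (@inner_semi _ H)) (semi0l (@inner_semi _ H)).
  rewrite (semiZ (@inner_semi _ H)) (semiZl (@inner_semi _ H)).
  rewrite (semiD (@inner_semi _ H)) (semiDl (@inner_semi _ H)) sX !IH.
  by congr (_ * _); rewrite conjc_inv conjc_nat.
have sZ : selfadj Z.
  move=> x z; apply/eqP; rewrite -subr_eq0; apply/eqP; apply: cabs_le0.
  apply: (@arch_le _ _ _ (2 * nrm x * nrm z + nrm x * (2 * nrm z))) => k.
  have -> : inner (Z x) z - inner x (Z z) =
     inner (Z x - sqrt_iter X k x) z - inner x (Z z - sqrt_iter X k z).
    rewrite (semiBl (@inner_semi _ H)) (semiB (@inner_semi _ H)) sY.
    by rewrite opprB addrA subrK.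
  rewrite add0r -[cabs _]/(normc _) (le_trans (le_normcD _ _)) // normcN -!/(cabs _).
  rewrite mulrDl lerD // (le_trans (inner_le _ _)) //.
    by rewrite -[leRHS]mulrAC ler_wpM2r ?nrm_ge0.
  by rewrite -mulrA ler_wpM2l ?nrm_ge0.
have fixZ x : Z x + Z x = X x + Z (Z x).
  apply/eqP; rewrite -subr_eq0; apply/eqP.
  apply: (@nrm_arch0 _ _ _ (8 * nrm x)) => k.
  have eY : sqrt_iter X k.+1 x + sqrt_iter X k.+1 x =
      X x + sqrt_iter X k (sqrt_iter X k x).
    have h2 : 2^-1 + 2^-1 = 1 :> R[i] by field.
    by rewrite /= -scalerDl h2 scale1r.
  have -> : Z x + Z x - (X x + Z (Z x)) =
    (Z x - sqrt_iter X k.+1 x) + (Z x - sqrt_iter X k.+1 x)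
      + (sqrt_iter X k (sqrt_iter X k x - Z x) + (sqrt_iter X k (Z x) - Z (Z x))).
    rewrite (linB (lY k)); set v := sqrt_iter X k (sqrt_iter X k x) in eY *.
    have -> : v - sqrt_iter X k (Z x) + (sqrt_iter X k (Z x) - Z (Z x)) = v - Z (Z x).
      by rewrite addrA subrK.
    set y := sqrt_iter X k.+1 x in eY *.
    have -> : Z x - y + (Z x - y) = Z x + Z x - (X x + v).
      by rewrite addrACA -opprD eY.
    by rewrite !opprD -!addrA addKr.
  have hk : 2 * nrm x / k.+2%:R <= 2 * nrm x / k.+1%:R.
    by rewrite ler_wpM2l ?mulr_ge0 ?nrm_ge0 // lef_pV2 ?posrE ?ltr0n // ler_nat.
  rewrite (_ : 8 * nrm x / k.+1%:R = (2 * nrm x / k.+1%:R + 2 * nrm x / k.+1%:R) +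
     (2 * nrm x / k.+1%:R + 2 * nrm x / k.+1%:R)); last by rewrite -!mulrDl; congr (_ / _); ring.
  rewrite (le_trans (nrmD _ _)) // lerD // (le_trans (nrmD _ _)) // lerD //.
  - by rewrite (le_trans (YZ _ _)).
  - by rewrite (le_trans (YZ _ _)).
  - by rewrite (le_trans (bY _ _)).
  - by rewrite (le_trans (hZ _ _)) // ler_wpM2r ?invr_ge0 // ler_wpM2l.
exists (fun x => x - Z x); split.
- apply: psd_intro.
  + by apply: lin_sub.
  + exists 2 => // x; rewrite (le_trans (nrmB _ _)) // mulr_natl mulr2n lerD2l.
    exact: cZ.
  + by move=> x z; rewrite (semiBl (@inner_semi _ H)) (semiB (@inner_semi _ H)) sZ.
  + move=> x; rewrite (semiB (@inner_semi _ H)) reD reN subr_ge0 -nrm_sqr.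
    apply: (le_trans (le_trans (ler_norm _) (re_le_cabs _))).
    by rewrite (le_trans (inner_le _ _)) // expr2 ler_wpM2l ?nrm_ge0.
- move=> x; rewrite (linB lZ) opprB.
  have -> : x - Z x + (Z (Z x) - Z x) = x + Z (Z x) - (Z x + Z x).
    by rewrite addrACA -opprD.
  by rewrite fixZ opprD addrACA subrr addr0 /X opprB addrC subrK.
- move=> B M e lB bB M0 e0 c k; apply: comm_id_sub => // x.
  have cXB : comm_le X B e by apply: comm_id_sub.
  have cY := sqrt_iter_comm k lX cX lB e0 cXB.
  have -> : Z (B x) - B (Z x) = (Z (B x) - sqrt_iter X k (B x)) +
      ((sqrt_iter X k (B x) - B (sqrt_iter X k x)) + B (sqrt_iter X k x - Z x)).
    by rewrite (linB lB) !addrA !subrK.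
  rewrite (_ : 4 * M / k.+1%:R = 2 * M / k.+1%:R + M * (2 / k.+1%:R)); last first.
    by rewrite mulrA -mulrDl; congr (_ / _); ring.
  rewrite [X in nrm X]addrCA mulrDl (le_trans (nrmD _ _)) // lerD //.
  rewrite mulrDl (le_trans (nrmD _ _)) // lerD //.
    by rewrite (le_trans (YZ _ _)) // [leRHS]mulrAC ler_wpM2r ?invr_ge0 // -mulrA ler_wpM2l.
  by rewrite (le_trans (bB _)) // -mulrA ler_wpM2l // (le_trans (hZ _ _)) // mulrAC.
Qed.

(** With [z := S x - S' x], commutation gives [(S + S') z = 0]; both forms being
    nonnegative, [S z = S' z = 0], and [|z|^2 = <x, (S - S') z>]. *)
Lemma psd_sqrt_unique S S' : psd S -> psd S' -> (forall x, S (S x) = S' (S' x)) ->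
  (forall x, S (S' x) = S' (S x)) -> forall x, S x = S' x.
Proof.
move=> pS pS' hh hc x; have lS := psd_lin pS; have lS' := psd_lin pS'.
set z := S x - S' x.
have z0 : S z + S' z = 0.
  by rewrite /z (linB lS) (linB lS') hc addrA subrK hh subrr.
have h : re (inner z (S z)) + re (inner z (S' z)) = 0.
  by rewrite -reD -(semiD (@inner_semi _ H)) z0 (semi0 (@inner_semi _ H)).
have h1 := psd_re z pS; have h2 := psd_re z pS'.
have Sz : S z = 0 by apply: psd_form0 pS _; lra.
have S'z : S' z = 0 by apply: psd_form0 pS' _; lra.
apply/eqP; rewrite -subr_eq0 -/z; apply/eqP; apply: nrm_le0.
rewrite -(ler_pXn2r (n := 2)) ?nnegrE ?nrm_ge0 // expr0n nrm_sqr {1}/z.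
rewrite (semiBl (@inner_semi _ H)) (psd_selfadj pS) (psd_selfadj pS') Sz S'z.
by rewrite (semi0 (@inner_semi _ H)) subrr.
Qed.

(** Any positive square root commutes with [T], hence, by the commutator estimate
    itself with [e = 0], with the root built above; so the two agree and the
    chosen root [psd_sqrt T] inherits the estimate. *)
Lemma psd_sqrtP T : effect T -> [/\ psd (psd_sqrt T), forall x, psd_sqrt T (psd_sqrt T x) = T x &
  forall B M e, linear B -> obnd B M -> 0 <= M -> 0 <= e -> comm_le T B e ->
    forall k, comm_le (psd_sqrt T) B (k%:R / 2 * e + 4 * M / k.+1%:R)].
Proof.
move=> eT; have [S [pS SS cS]] := sqrt_exists eT.
have [pS' SS'] : [set S : H -> H | psd S /\ forall x, S (S x) = T x] (psd_sqrt T).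
  by apply: (xgetPex (fun=> 0)); exists S.
suff : psd_sqrt T = S by move=> ->.
apply/funext; apply: psd_sqrt_unique => // x; first by rewrite SS SS'.
have [_ [M M0 bM]] := (bounded_opP _).1 pS'.1.
have lS' := psd_lin pS'.
have c0 : comm_le T (psd_sqrt T) 0 by move=> z; rewrite -!SS' subrr nrm0 mul0r.
apply/eqP; rewrite eq_sym -subr_eq0; apply/eqP.
apply: (@nrm_arch0 _ _ _ (4 * M * nrm x)) => k.
by have := cS _ _ _ lS' bM M0 (lexx 0) c0 k x; rewrite mulr0 add0r mulrAC.
Qed.

End SquareRoot.

Section Bullet.
Variables (R : realType) (H : hilbertType R).
Implicit Types (S T A B : H -> H) (x y z : H).
Local Notation isem := (@inner_semi R H).

Lemma povm_effect m (A : 'I_m -> H -> H) k : povm A -> effect (A k).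
Proof. by move=> pA; split; [exact: povm_psd|move=> x; exact: povm_le1]. Qed.

Lemma effect_contr T : effect T -> contr T.
Proof. by move=> [pT T1]; exact: psd_contr. Qed.

Lemma sqrt_contr S T : psd S -> (forall x, S (S x) = T x) -> effect T -> contr S.
Proof.
move=> pS ST [_ T1] x; rewrite -(ler_pXn2r (n := 2)) ?nnegrE ?nrm_ge0 //.
by rewrite nrm_sqr (psd_selfadj pS) ST.
Qed.

Lemma contr_obnd T : contr T -> obnd T 1.
Proof. by move=> cT x; rewrite mul1r. Qed.

(** Bounds, with no reference to dimension, the commutator with a square root
    by the commutator with the operator; the free [k] balances the two terms. *)
Definition sqrt_modulus (k : nat) (e : R) : R := k%:R / 2 * e + 4 / k.+1%:R.

Lemma sqrt_modulus_ge0 k e : 0 <= e -> 0 <= sqrt_modulus k e.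
Proof. by move=> e0; rewrite addr_ge0 ?mulr_ge0 ?invr_ge0 ?divr_ge0. Qed.

Lemma sqrt_modulus_lt (d : R) : 0 < d -> exists k e, 0 < e /\ sqrt_modulus k e < d.
Proof.
move=> d0; pose k := Num.truncn (8 / d).
have hk : 4 / k.+1%:R < d / 2.
  rewrite ltr_pdivrMr ?ltr0n // mulrC mulrA ltr_pdivlMr // (_ : 4 * 2 = 8); last by ring.
  by rewrite -ltr_pdivrMr //; exact: truncnS_gt.
exists k, (d / 2 / k.+1%:R); split; first by rewrite !divr_gt0.
rewrite /sqrt_modulus; apply: (@le_lt_trans _ _ (d / 2 / 2 + 4 / k.+1%:R)); last first.
  by rewrite -(ltrD2l (d / 2 / 2)) in hk; apply: (lt_trans hk); lra.
rewrite lerD2r mulrAC ler_wpM2r ?invr_ge0 // mulrCA.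
have kk : k%:R / k.+1%:R <= 1 :> R by rewrite ler_pdivrMr ?ltr0n // mul1r ler_nat.
have d20 : 0 <= d / 2 by rewrite divr_ge0 // ltW.
by have := ler_wpM2l d20 kk; rewrite mulr1.
Qed.

Lemma sqrt_comm_le T B e k : effect T -> linear B -> contr B -> 0 <= e ->
  comm_le T B e -> comm_le (psd_sqrt T) B (sqrt_modulus k e).
Proof.
move=> eT lB cB e0 c; have [_ _ h] := psd_sqrtP eT.
by have := h B 1 e lB (contr_obnd cB) ler01 e0 c k; rewrite mulr1.
Qed.

(** With the roots [S] of [A] and [T] of [B], [S B S - A B = S [B, S]] and
    [T A T - A B = [T, A] T]. *)
Lemma bullet_close A B e k : effect A -> effect B -> 0 <= e -> comm_le A B e ->
  forall x, nrm (bullet A B x - A (B x)) <= sqrt_modulus k e * nrm x.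
Proof.
move=> eA eB e0 c x.
have [pS SS _] := psd_sqrtP eA; have [pT TT _] := psd_sqrtP eB.
have cA := effect_contr eA; have cB := effect_contr eB.
have lA := psd_lin eA.1; have lB := psd_lin eB.1.
have cS := sqrt_contr pS SS eA; have cT := sqrt_contr pT TT eB.
have lS := psd_lin pS; have lT := psd_lin pT.
have h1 := sqrt_comm_le k eA lB cB e0 c.
have h2 := sqrt_comm_le k eB lA cA e0 (comm_sym c).
rewrite /bullet; set S := psd_sqrt A in SS cS lS h1 *.
set T := psd_sqrt B in TT cT lT h2 *.
have -> : 2^-1 *: (S (B (S x)) + T (A (T x))) - A (B x) =
   2^-1 *: (S (B (S x) - S (B x)) + (T (A (T x)) - A (T (T x)))).
  have h : A (B x) = 2^-1 *: (A (B x) + A (B x)).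
    have h2' : 2^-1 + 2^-1 = 1 :> R[i] by field.
    by rewrite scalerDr -scalerDl h2' scale1r.
  by rewrite {1}h -scalerBr (linB lS) SS TT opprD addrACA.
rewrite nrmZ cabs_half.
suff : nrm (S (B (S x) - S (B x)) + (T (A (T x)) - A (T (T x)))) <=
   sqrt_modulus k e * nrm x + sqrt_modulus k e * nrm x.
  by move=> ?; rewrite mulrC ler_pdivrMr // mulr_natr mulr2n.
rewrite (le_trans (nrmD _ _)) // lerD //.
  by rewrite (le_trans (cS _)) // nrm_distC h1.
by rewrite (le_trans (h2 _)) // ler_wpM2l // sqrt_modulus_ge0.
Qed.

Lemma finite_dim_fin (J : finType) (e : J -> H) :
  (forall x, exists c : J -> R[i], x = \sum_j c j *: e j) -> finite_dim H.
Proof.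
move=> h; exists #|J|, (fun i => e (enum_val i)) => x.
have [c ->] := h x; exists (fun i => c (enum_val i)).
by rewrite (reindex (@enum_val J predT)) //=; exact/onW_bij/enum_val_bij.
Qed.

End Bullet.

(** * Direct sums and dilation *)

Section DirectSum.
Variables (R : realType) (H : hilbertType R) (I : finType).
Local Notation isem := (@inner_semi R H).

Definition dsum_form (x y : {ffun I -> H}) : R[i] := \sum_o inner (x o) (y o).

Lemma dsum_semi : semi_inner dsum_form.
Proof.
split=> [z a x y|x y|x]; rewrite /dsum_form.
- rewrite mulr_sumr -big_split /=; apply: eq_bigr => o _.
  by rewrite !ffunE (semi_lin isem).
- by rewrite rmorph_sum /=; apply: eq_bigr => o _; rewrite innerC.
- by rewrite re_sum sumr_ge0 // => o _; rewrite -nrm_sqr sqr_ge0.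
Qed.

Lemma dsum_comp_le (x : {ffun I -> H}) o : nrm (x o) <= semi_norm dsum_form x.
Proof.
rewrite -(ler_pXn2r (n := 2)) ?nnegrE ?nrm_ge0 ?semi_norm_ge0 //.
rewrite (semi_norm_sqr dsum_semi) nrm_sqr re_sum (bigD1 o) //= lerDl.
by rewrite sumr_ge0 // => j _; rewrite -nrm_sqr sqr_ge0.
Qed.

Lemma dsum_le (x : {ffun I -> H}) : semi_norm dsum_form x <= \sum_o nrm (x o).
Proof.
rewrite -(ler_pXn2r (n := 2)) ?nnegrE ?semi_norm_ge0 ?sumr_ge0 //; last first.
  by move=> o _; exact: nrm_ge0.
rewrite (semi_norm_sqr dsum_semi) re_sum expr2 mulr_suml ler_sum // => o _.
rewrite -nrm_sqr expr2 ler_wpM2l ?nrm_ge0 // (bigD1 o) //= lerDl sumr_ge0 // => j _.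
exact: nrm_ge0.
Qed.

Lemma dsum_complete : fast_complete dsum_form.
Proof.
move=> u hu.
have /choice[l hl] : forall o, exists l, forall k, nrm (u k o - l) <= 1 / k.+1%:R.
  move=> o; apply: hilbert_fast_cvg => i j; rewrite mul1r.
  apply: le_trans (hu i j).
  by have := dsum_comp_le (u i - u j) o; rewrite !ffunE.
exists [ffun o => l o], #|I|%:R => k.
rewrite (le_trans (dsum_le _)) //.
apply: (@le_trans _ _ (\sum_(o : I) 1 / k.+1%:R)); last first.
  by rewrite sumr_const div1r [leRHS]mulr_natl lexx.
by apply: ler_sum => o _; rewrite !ffunE.
Qed.

(** [pr] are the coordinates and [tup] assembles a vector from them; the listed
    properties are all that the dilation uses. *)
Lemma direct_sum : exists (K : hilbertType R) (pr : I -> K -> H) (tup : (I -> H) -> K),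
  [/\ forall o, linear (pr o), forall x o, pr o (tup x) = x o,
      forall y z, inner y z = \sum_o inner (pr o y) (pr o z) &
      finite_dim H -> finite_dim K].
Proof.
have [K [q [lq qs qi]]] := hilbert_quotient dsum_semi dsum_complete.
have /choice[r hr] : forall y, exists x, q x = y by [].
have q_inj x x' : q x = q x' -> x = x'.
  move=> h; apply/ffunP => o; apply/eqP; rewrite -subr_eq0; apply/eqP/nrm_le0.
  have := dsum_comp_le (x - x') o; rewrite !ffunE => /le_trans; apply.
  rewrite /semi_norm -!qi.
  have -> : q (x - x') = 0 by rewrite (linB lq) h subrr.
  by rewrite (semi0 (@inner_semi R K)) sqrtr0.
exists K, (fun o y => r y o), (fun x => q [ffun o => x o]); split.
- move=> o a y z; rewrite -[in RHS](hr y) -[in RHS](hr z) !hr.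
  have -> : r (a *: y + z) = a *: r y + r z by apply: q_inj; rewrite lq !hr.
  by rewrite !ffunE.
- by move=> x o; rewrite (q_inj _ _ (hr _)) ffunE.
- by move=> y z; rewrite -{1}(hr y) -{1}(hr z) qi.
move=> [N [e he]].
apply: (@finite_dim_fin _ _ (I * 'I_N)%type
  (fun p => q [ffun o => if o == p.1 then e p.2 else 0])) => y.
have /choice[c hc] : forall o, exists c : 'I_N -> R[i], r y o = \sum_(i < N) c i *: e i.
  by move=> o; exact: he.
exists (fun p => c p.1 p.2); rewrite -(hr y).
transitivity (q (\sum_(p : I * 'I_N) c p.1 p.2 *: [ffun o => if o == p.1 then e p.2 else 0])).
  congr q; apply/ffunP => o; rewrite sum_ffunE hc.
  rewrite -(pair_bigA _ (fun o' i => (c o' i *: [ffun o0 => if o0 == o' then e i else 0]) o)) /=.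
  rewrite (bigD1 o) //= [X in _ + X]big1 ?addr0.
    by apply: eq_bigr => i _; rewrite !ffunE eqxx.
  move=> j jo; rewrite big1 // => i _; rewrite !ffunE eq_sym (negbTE jo).
  by rewrite scaler0.
by rewrite (lin_sum lq); apply: eq_bigr => p _; rewrite (linZ lq).
Qed.

End DirectSum.

Section Dilation.
Variables (R : realType) (H : hilbertType R) (m : nat).
Local Notation isem := (@inner_semi R H).

Variables (K : hilbertType R) (pr : 'I_m.+1 -> K -> H) (tup : ('I_m.+1 -> H) -> K).
Hypothesis lpr : forall o, linear (pr o).
Hypothesis pr_tup : forall x o, pr o (tup x) = x o.
Hypothesis innerK : forall y z, inner y z = \sum_o inner (pr o y) (pr o z).
Local Notation ksem := (@inner_semi R K).
Local Notation s0 := (lift ord0).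

Lemma pr_ext y z : (forall o, pr o y = pr o z) -> y = z.
Proof.
move=> h; apply/eqP; rewrite -subr_eq0; apply/eqP/nrm_le0.
rewrite -(ler_pXn2r (n := 2)) ?nnegrE ?nrm_ge0 // expr0n nrm_sqr innerK.
by rewrite big1 // => o _; rewrite (linB (lpr o)) h subrr (semi0 isem).
Qed.

Lemma nrm_pr_le o y : nrm (pr o y) <= nrm y.
Proof.
rewrite -(ler_pXn2r (n := 2)) ?nnegrE ?nrm_ge0 // !nrm_sqr innerK re_sum.
by rewrite (bigD1 o) //= lerDl sumr_ge0 // => j _; rewrite -nrm_sqr sqr_ge0.
Qed.

Lemma nrm_le_pr y (M : 'I_m.+1 -> R) :
  (forall o, nrm (pr o y) <= M o) -> nrm y <= \sum_o M o.
Proof.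
move=> h; have M0 o : 0 <= M o by exact: le_trans (nrm_ge0 _) (h o).
rewrite -(ler_pXn2r (n := 2)) ?nnegrE ?nrm_ge0 ?sumr_ge0 // nrm_sqr innerK re_sum.
rewrite expr2 mulr_suml ler_sum // => o _.
rewrite -nrm_sqr expr2 ler_pM ?nrm_ge0 // (le_trans (h o)) // (bigD1 o) //= lerDl.
by rewrite sumr_ge0.
Qed.

Lemma prZD o a y z : pr o (a *: y + z) = a *: pr o y + pr o z.
Proof. exact: lpr. Qed.

Definition embed (x : H) : K := tup (fun o => if unlift ord0 o is Some _ then 0 else x).

(** The operator [B (x) 1] on [K], seen as the tensor product of [H] with
    [C^(m+1)]. *)
Definition amp (B : H -> H) (y : K) : K := tup (fun o => B (pr o y)).

Lemma embed_lin : linear embed.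
Proof.
move=> a y z; apply: pr_ext => o; rewrite prZD !pr_tup.
by case: (unlift _ _) => // _; rewrite scaler0 addr0.
Qed.

Lemma inner_embed x y : inner (embed x) (embed y) = inner x y.
Proof.
rewrite innerK big_ord_recl !pr_tup unlift_none big1 ?addr0 // => j _.
by rewrite !pr_tup liftK (semi0 isem).
Qed.

Lemma amp_lin B : linear B -> linear (amp B).
Proof. by move=> lB a y z; apply: pr_ext => o; rewrite prZD !pr_tup prZD lB. Qed.

Lemma amp_embed B x : linear B -> amp B (embed x) = embed (B x).
Proof.
move=> lB; apply: pr_ext => o; rewrite !pr_tup.
by case: (unlift _ _) => // _; rewrite (lin0 lB).
Qed.

Lemma amp_obnd B : linear B -> (exists2 M : R, 0 <= M & obnd B M) ->
  exists2 M : R, 0 <= M & obnd (amp B) M.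
Proof.
move=> lB [M M0 bB]; exists (\sum_(o < m.+1) M) => [|y]; first by rewrite sumr_ge0.
rewrite mulr_suml; apply: nrm_le_pr => o; rewrite pr_tup (le_trans (bB _)) //.
by rewrite ler_wpM2l // nrm_pr_le.
Qed.

Lemma amp_psd B : psd B -> psd (amp B).
Proof.
move=> pB; have lB := psd_lin pB; apply: psd_intro.
- exact: amp_lin.
- by apply: amp_obnd => //; have [_] := (bounded_opP B).1 pB.1.
- move=> y z; rewrite !innerK; apply: eq_bigr => o _.
  by rewrite !pr_tup (psd_selfadj pB).
- move=> y; rewrite innerK re_sum sumr_ge0 // => o _.
  by rewrite pr_tup psd_re.
Qed.

Lemma amp_povm m' (B : 'I_m' -> H -> H) : povm B -> povm (fun i => amp (B i)).
Proof.
move=> pB; split=> [k|y]; first exact/amp_psd/povm_psd.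
apply: pr_ext => o; rewrite (big_morph (pr o) (linD (lpr o)) (lin0 (lpr o))).
by rewrite -[RHS]pB.2; apply: eq_bigr => j _; rewrite pr_tup.
Qed.

Lemma amp_projective m' (B : 'I_m' -> H -> H) :
  projective_povm B -> projective_povm (fun i => amp (B i)).
Proof.
move=> [pB oB]; split; first exact: amp_povm.
move=> j; have pB' := amp_psd (povm_psd pB j); split; first exact: pB'.1.
- by move=> y; apply: pr_ext => o; rewrite !pr_tup; case: (oB j).
- exact: psd_selfadj.
Qed.

Section OnePOVM.
Variable A : 'I_m -> H -> H.
Hypothesis pA : povm A.
Variable i0 : 'I_m.
Local Notation r i := (psd_sqrt (A i)).

Lemma sqrtA_psd i : psd (r i).
Proof. by have [] := psd_sqrtP (povm_effect i pA). Qed.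
Lemma sqrtA_sqr i x : r i (r i x) = A i x.
Proof. by have [_ h _] := psd_sqrtP (povm_effect i pA). Qed.
Let lr i : linear (r i) := psd_lin (sqrtA_psd i).

(** [dcol] is [W - J] for the two isometries [W x = (0, r_1 x, ..., r_m x)] and
    [J = embed], and [drow] is its adjoint. *)
Definition dcol (x : H) : K := tup (fun o => if unlift ord0 o is Some i then r i x else - x).
Definition drow (y : K) : H := \sum_i r i (pr (s0 i) y) - pr ord0 y.
Definition flip (y : K) : K := y - dcol (drow y).

Lemma pr_dcol0 x : pr ord0 (dcol x) = - x.
Proof. by rewrite pr_tup unlift_none. Qed.
Lemma pr_dcolS i x : pr (s0 i) (dcol x) = r i x.
Proof. by rewrite pr_tup liftK. Qed.

Lemma dcol_lin : linear dcol.
Proof.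
move=> a y z; apply: pr_ext => o; rewrite prZD !pr_tup.
by case: (unlift _ _) => [i|]; [exact: lr|rewrite opprD scalerN].
Qed.

Lemma drow_lin : linear drow.
Proof.
move=> a y z; rewrite /drow prZD scalerBr addrACA -opprD scaler_sumr -big_split /=.
by congr (_ - _); apply: eq_bigr => i _; rewrite prZD lr.
Qed.

Lemma dcol_adj x y : inner (dcol x) y = inner x (drow y).
Proof.
rewrite innerK big_ord_recl pr_dcol0 /drow (semiB isem) (semi_sumr isem).
rewrite (semiNl isem) addrC; congr (_ - _); apply: eq_bigr => i _.
by rewrite pr_dcolS (psd_selfadj (sqrtA_psd i)).
Qed.

Lemma drow_dcol x : drow (dcol x) = x + x.
Proof.
rewrite /drow pr_dcol0 opprK; congr (_ + _); rewrite -[RHS]pA.2.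
by apply: eq_bigr => i _; rewrite pr_dcolS sqrtA_sqr.
Qed.

Lemma flip_lin : linear flip.
Proof. by apply: lin_sub => // a y z; rewrite drow_lin dcol_lin. Qed.

(** [drow] after [dcol] is twice the identity, so [flip = 1 - dcol drow] is the
    reflection in the range of [dcol]; it exchanges [W] and [J]. *)
Lemma flipK y : flip (flip y) = y.
Proof.
rewrite /flip (linB drow_lin) drow_dcol.
rewrite opprD addrA subrr sub0r (linN dcol_lin) opprK subrK //.
Qed.

Lemma flip_selfadj : selfadj flip.
Proof.
move=> y z; rewrite /flip (semiB ksem) (semiBl ksem) dcol_adj.
by rewrite (innerC y (dcol _)) dcol_adj -innerC.
Qed.

Lemma nrm_flip y : nrm (flip y) = nrm y.
Proof.
apply/eqP; rewrite -(eqrXn2 (n := 2)) ?nrm_ge0 //.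
by rewrite !nrm_sqr flip_selfadj flipK.
Qed.

Lemma pr_flip_embed x o :
  pr o (flip (embed x)) = if unlift ord0 o is Some i then r i x else 0.
Proof.
have dx : drow (embed x) = - x.
  rewrite /drow {2}/embed pr_tup unlift_none big1 ?sub0r // => i _.
  by rewrite /embed pr_tup liftK (lin0 (lr _)).
rewrite /flip dx (linN dcol_lin) opprK (linD (lpr o)) !pr_tup.
by case: (unlift _ _) => [i|]; rewrite ?add0r ?subrr.
Qed.

(** Which outcome a coordinate counts for. The coordinate [ord0] has to count for
    some outcome, as the projections must add up to [1]; [flip] takes the range of
    [embed] to vectors that vanish there. *)
Definition outcome (o : 'I_m.+1) : 'I_m := if unlift ord0 o is Some i then i else i0.
Definition coord_proj (j : 'I_m) (y : K) : K :=
  tup (fun o => if outcome o == j then pr o y else 0).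
Definition dilated (j : 'I_m) (y : K) : K := flip (coord_proj j (flip y)).

Lemma coord_proj_lin j : linear (coord_proj j).
Proof.
move=> a y z; apply: pr_ext => o; rewrite prZD !pr_tup prZD.
by case: ifP => // _; rewrite scaler0 addr0.
Qed.

Lemma coord_proj_idem j y : coord_proj j (coord_proj j y) = coord_proj j y.
Proof. by apply: pr_ext => o; rewrite !pr_tup; case: eqP. Qed.

Lemma coord_proj_selfadj j : selfadj (coord_proj j).
Proof.
move=> y z; rewrite !innerK; apply: eq_bigr => o _; rewrite !pr_tup.
by case: ifP => _; rewrite ?(semi0 isem) ?(semi0l isem).
Qed.

Lemma coord_proj_contr j : contr (coord_proj j).
Proof. exact: selfadj_idem_contr (coord_proj_selfadj j) (coord_proj_idem j). Qed.

Lemma sum_coord_proj y : \sum_j coord_proj j y = y.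
Proof.
apply: pr_ext => o; rewrite (lin_sum (lpr o)) (bigD1 (outcome o)) //= big1 ?addr0.
  by rewrite pr_tup eqxx.
by move=> j jo; rewrite pr_tup ifN // eq_sym.
Qed.

Lemma dilated_lin j : linear (dilated j).
Proof. by move=> a y z; rewrite /dilated flip_lin coord_proj_lin flip_lin. Qed.

Lemma dilated_contr j : contr (dilated j).
Proof. by move=> y; rewrite /dilated nrm_flip (le_trans (coord_proj_contr _ _)) ?nrm_flip. Qed.

Lemma dilated_selfadj j : selfadj (dilated j).
Proof. by move=> y z; rewrite /dilated flip_selfadj coord_proj_selfadj flip_selfadj. Qed.

Lemma dilated_projective : projective_povm dilated.
Proof.
have bP j : bounded_op (dilated j).
  exact: contr_bounded (@dilated_lin j) (@dilated_contr j).
have iP j y : dilated j (dilated j y) = dilated j y.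
  by rewrite /dilated flipK coord_proj_idem.
split; last by move=> j; split; [exact: bP|exact: iP|exact: dilated_selfadj].
split=> [j|y]; last by rewrite -(lin_sum flip_lin) sum_coord_proj flipK.
apply: psd_intro.
- exact: dilated_lin.
- by exists 1 => // y; rewrite mul1r dilated_contr.
- exact: dilated_selfadj.
- by move=> y; rewrite -iP -dilated_selfadj -nrm_sqr sqr_ge0.
Qed.

(** [flip] maps [embed x] to [(0, r_1 x, ..., r_m x)], whose [j]-th coordinate
    has squared length [<x, A_j x>]. *)
Lemma dilated_compress j x y : inner (embed x) (dilated j (embed y)) = inner x (A j y).
Proof.
rewrite /dilated -flip_selfadj innerK big_ord_recl pr_flip_embed unlift_none.
rewrite (semi0l isem) add0r (bigD1 j) //= big1 => [|k kj].
  rewrite addr0 pr_flip_embed liftK pr_tup /outcome liftK eqxx pr_flip_embed liftK.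
  by rewrite (psd_selfadj (sqrtA_psd j)) sqrtA_sqr.
by rewrite [X in inner _ X]pr_tup /outcome liftK (negbTE kj) (semi0 isem).
Qed.

Lemma dcol_le x : nrm (dcol x) <= 2 * nrm x.
Proof.
rewrite -(ler_pXn2r (n := 2)) ?nnegrE ?mulr_ge0 ?nrm_ge0 //.
rewrite nrm_sqr dcol_adj drow_dcol (semiD isem) reD -nrm_sqr exprMn.
by have := sqr_ge0 (nrm x); lra.
Qed.

Lemma drow_le y : nrm (drow y) <= 2 * nrm y.
Proof.
have h : nrm (drow y) ^+ 2 <= 2 * nrm (drow y) * nrm y.
  rewrite nrm_sqr -dcol_adj (le_trans (ler_norm _)) // (le_trans (re_le_cabs _)) //.
  by rewrite (le_trans (inner_le _ _)) // ler_wpM2r ?nrm_ge0 // dcol_le.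
have := nrm_ge0 (drow y); rewrite le_eqVlt => /orP[/eqP<-|p].
  by rewrite mulr_ge0 ?nrm_ge0.
by rewrite -(ler_pM2l p) -expr2 mulrCA mulrA.
Qed.

(** The coordinates of [dcol] and [drow] are the roots [r i] and a scalar, so each
    commutator is a sum of [m] commutators of roots. *)
Lemma flip_comm B e : linear B -> contr B -> 0 <= e ->
  (forall i, comm_le (r i) B e) -> comm_le flip (amp B) (4 * m%:R * e).
Proof.
move=> lB cB e0 c y.
have lB' := amp_lin lB.
have dB x : nrm (dcol (B x) - amp B (dcol x)) <= m%:R * e * nrm x.
  have -> : m%:R * e * nrm x = \sum_(o < m.+1) (if unlift ord0 o is Some _ then e * nrm x else 0).
    rewrite big_ord_recl unlift_none add0r (eq_bigr (fun=> e * nrm x)); last first.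
      by move=> i _; rewrite liftK.
    by rewrite sumr_const card_ord -mulrA mulr_natl.
  apply: nrm_le_pr => o; rewrite (linB (lpr o)) !pr_tup.
  case: (unlift _ _) => [i|]; first exact: c.
  by rewrite (linN lB) subrr nrm0.
have Bd z : nrm (drow (amp B z) - B (drow z)) <= m%:R * e * nrm z.
  have -> : drow (amp B z) - B (drow z) =
      \sum_i (r i (B (pr (s0 i) z)) - B (r i (pr (s0 i) z))).
    rewrite /drow (linB lB) (lin_sum lB) sumrB pr_tup.
    rewrite opprD opprK addrACA addNr addr0; congr (_ - _).
    by apply: eq_bigr => i _; rewrite pr_tup.
  rewrite (le_trans (nrm_sum _ _ _)) // -mulrA mulr_natl -[X in _ *+ X](card_ord m).
  rewrite -sumr_const ler_sum // => i _.
  by rewrite (le_trans (c _ _)) // ler_wpM2l // nrm_pr_le.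
have -> : flip (amp B y) - amp B (flip y) =
    - (dcol (drow (amp B y) - B (drow y)) + (dcol (B (drow y)) - amp B (dcol (drow y)))).
  rewrite /flip (linB lB') (linB dcol_lin (drow (amp B y))); set u := dcol (drow (amp B y)).
  set v := dcol (B (drow y)); set w := amp B (dcol (drow y)).
  have -> : u - v + (v - w) = u - w by rewrite addrA subrK.
  by rewrite !opprB addrC addrA subrK.
rewrite nrmN (le_trans (nrmD _ _)) //.
have h1 := le_trans (dcol_le _) (ler_wpM2l (ler0n R 2) (Bd y)).
have h2 := le_trans (dB (drow y)) (ler_wpM2l (mulr_ge0 (ler0n R m) e0) (drow_le y)).
by apply: (le_trans (lerD h1 h2)); rewrite le_eqVlt; apply/orP; left; apply/eqP; ring.
Qed.

Lemma dilated_comm B e j : linear B -> contr B -> 0 <= e ->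
  (forall i, comm_le (r i) B e) -> comm_le (dilated j) (amp B) (8 * m%:R * e).
Proof.
move=> lB cB e0 c.
have cf := flip_comm lB cB e0 c.
have c1 : obnd (coord_proj j \o flip) 1.
  by move=> y; rewrite mul1r /= (le_trans (coord_proj_contr _ _)) ?nrm_flip.
have f1 : obnd flip 1 by move=> y; rewrite mul1r nrm_flip.
have p1 := contr_obnd (@coord_proj_contr j).
have cp : comm_le (coord_proj j) (amp B) 0.
  move=> y; rewrite mul0r (_ : _ - _ = 0) ?nrm0 //; apply/eqP; rewrite subr_eq0; apply/eqP.
  by apply: pr_ext => o; rewrite !pr_tup; case: ifP => _ //; rewrite (lin0 lB).
have ce : 0 <= 4 * m%:R * e by rewrite !mulr_ge0.
have h1 := comm_comp (@coord_proj_lin j) p1 f1 ler01 (lexx 0) cp cf.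
have := comm_comp flip_lin f1 c1 ler01 ce cf h1.
by rewrite mul0r add0r !mul1r mulr1 -mulrDl -mulrDl -natrD.
Qed.

End OnePOVM.
End Dilation.

(** One space serves all the POVMs [A k], since their reflections act on the same
    [m + 1] copies of [H]; [am] is the amplification to these copies. The
    commutator bound keeps an operator that nearly commutes with the square roots
    nearly commuting, once amplified, with the projections. *)
Lemma simultaneous_dilation (R : realType) (H : hilbertType R) (m d : nat)
    (A : 'I_d -> 'I_m -> H -> H) :
  (0 < m)%N -> (forall k, povm (A k)) -> finite_dim H ->
  exists (K : hilbertType R) (J : H -> K) (P : 'I_d -> 'I_m -> K -> K)
    (am : (H -> H) -> K -> K),
  [/\ finite_dim K, linear J, forall x y, inner (J x) (J y) = inner x y,
      (forall k, projective_povm (P k)) /\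
      (forall k i x y, inner (J x) (P k i (J y)) = inner x (A k i y)) &
      [/\ forall m' (B : 'I_m' -> H -> H), povm B -> povm (fun i => am (B i)),
          forall m' (B : 'I_m' -> H -> H),
            projective_povm B -> projective_povm (fun i => am (B i)),
          forall B x, linear B -> am B (J x) = J (B x) &
          forall k B e, linear B -> contr B -> 0 <= e ->
            (forall i, comm_le (psd_sqrt (A k i)) B e) ->
            forall i, comm_le (P k i) (am B) (8 * m%:R * e)]].
Proof.
move=> m0 pA fH; have [K [pr [tup [lpr prt iK fK]]]] := direct_sum H 'I_m.+1.
exists K, (embed tup), (fun k => dilated pr tup (A k) (Ordinal m0)), (amp pr tup).
split; [exact: fK|exact: embed_lin|exact: inner_embed| |].
  split=> [k|k i x y]; first by apply: dilated_projective.
  by apply: dilated_compress.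
split.
- by move=> m' B; apply: amp_povm.
- by move=> m' B; apply: amp_projective.
- by move=> B x; apply: amp_embed.
- by move=> k B e lB cB e0 c i; apply: dilated_comm.
Qed.

(** * Finite-dimensional cut-offs *)

Section FiniteRank.
Variables (R : realType) (H : hilbertType R).
Implicit Types (P T g : H -> H) (x y v : H).
Local Notation isem := (@inner_semi R H).

Definition finite_rank_proj P : Prop :=
  [/\ linear P, selfadj P, forall x, P (P x) = P x &
      exists (N : nat) (e : 'I_N -> H),
        forall x, exists c : 'I_N -> R[i], P x = \sum_i c i *: e i].

(** Taking adjoints in [P' P = P]. *)
Lemma absorb_sym P P' : selfadj P -> selfadj P' -> (forall x, P' (P x) = P x) ->
  forall x, P (P' x) = P x.
Proof.
move=> sP sP' h x; apply/eqP; rewrite -subr_eq0; apply/eqP/nrm_le0.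
rewrite -(ler_pXn2r (n := 2)) ?nnegrE ?nrm_ge0 // expr0n nrm_sqr.
set y := _ - _; rewrite {2}/y (semiB isem) -!sP -sP' h subrr //.
Qed.

(** One Gram-Schmidt step. If [v] is already in the range of [P] then [w = 0],
    and the convention [0^-1 = 0] makes the new term vanish. *)
Lemma finite_rank_proj_add P v : finite_rank_proj P ->
  exists P', [/\ finite_rank_proj P', forall x, P' (P x) = P x & P' v = v].
Proof.
move=> [lP sP iP [N [e he]]]; have [w wE] : exists w, w = v - P v by exists (v - P v).
have Pw : P w = 0 by rewrite wE (linB lP) iP subrr.
have wP x : inner w (P x) = 0 by rewrite -sP Pw (semi0l isem).
pose c := (inner w w)^-1.
have cc : conjc c = c by rewrite /c conjc_inv -innerC.
have ww a : (a * inner w w * c) *: w = a *: w.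
  have [->|w0] := eqVneq w 0; first by rewrite !scaler0.
  rewrite /c mulfK // inner_selfE; apply/eqP => -[] /eqP; rewrite sqrf_eq0 => /eqP h.
  by move/eqP: w0; apply; apply: nrm_le0; rewrite h.
exists (fun x => P x + (inner w x * c) *: w); split.
- split.
  + move=> a x y; rewrite lP (semi_lin isem) scalerDr scalerA addrACA -scalerDl.
    by rewrite mulrDl mulrA.
  + move=> x y; rewrite (semiD isem) (semiDl isem) sP (semiZ isem) (semiZl isem).
    by rewrite rmorphM /= cc -innerC; congr (_ + _); ring.
  + move=> x; rewrite (linD lP) iP (linZ lP) Pw scaler0 addr0.
    by rewrite (semiD isem) wP add0r (semiZ isem) ww.
  + exists N.+1, (fun i => if unlift ord0 i is Some j then e j else w) => x.
    have [b hb] := he x.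
    exists (fun i => if unlift ord0 i is Some j then b j else inner w x * c).
    rewrite big_ord_recl unlift_none addrC hb; congr (_ + _).
    by apply: eq_bigr => i _; rewrite liftK.
- by move=> x; rewrite iP wP mul0r scale0r addr0.
- have -> : inner w v = 1 * inner w w by rewrite mul1r {3}wE (semiB isem) wP subr0.
  by rewrite ww scale1r wE addrC subrK.
Qed.

Lemma finite_rank_proj_add_seq P (s : seq H) : finite_rank_proj P ->
  exists P', [/\ finite_rank_proj P', forall x, P' (P x) = P x &
    forall v, v \in s -> P' v = v].
Proof.
move=> fP; elim: s => [|v s [P1 [fP1 h1 hs]]].
  by exists P; split => //; case: fP.
have [P2 [fP2 h2 hv]] := finite_rank_proj_add v fP1.
exists P2; split => // [x|u]; first by rewrite -[in LHS]h1 h2 h1.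
by rewrite inE => /orP[/eqP->//|/hs hu]; rewrite -[in LHS]hu h2 hu.
Qed.

Lemma finite_rank_proj0 : finite_rank_proj (fun=> 0).
Proof.
split=> //; first by move=> a x y; rewrite scaler0 addr0.
  by move=> x y; rewrite (semi0 isem) (semi0l isem).
exists 0%N, (fun=> 0) => x; exists (fun=> 0); by rewrite big_ord0.
Qed.

Section Chain.
Variables (J : finType) (T : J -> H -> H).
Hypotheses (lT : forall j, linear (T j)) (sT : forall j, selfadj (T j))
  (cT : forall j, contr (T j)).

(** The range of [P'] contains the image of the range of [P] under every [T j]: it
    suffices to absorb the images of a spanning family. *)
Lemma finite_rank_proj_step P : finite_rank_proj P ->
  exists P', [/\ finite_rank_proj P', forall x, P' (P x) = P x &
    forall j x, P' (T j (P x)) = T j (P x)].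
Proof.
move=> fP; have [_ _ _ [N [e he]]] := fP.
have [P' [fP' h1 h2]] :=
  finite_rank_proj_add_seq [seq T p.1 (e p.2) | p <- enum {: J * 'I_N}] fP.
exists P'; split => // j x; have [c ->] := he x; have [lP' _ _ _] := fP'.
rewrite (lin_sum (lT j)) (lin_sum lP'); apply: eq_bigr => i _.
rewrite (linZ (lT j)) (linZ lP') h2 //.
by apply/mapP; exists (j, i) => //; rewrite mem_enum.
Qed.

Variable E : nat -> H -> H.
Hypotheses (fE : forall k, finite_rank_proj (E k))
  (E_S : forall k x, E k.+1 (E k x) = E k x)
  (T_E : forall k j x, E k.+1 (T j (E k x)) = T j (E k x)).

Let lE k : linear (E k). Proof. by case: (fE k). Qed.
Let sE k : selfadj (E k). Proof. by case: (fE k). Qed.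
Let iE k x : E k (E k x) = E k x. Proof. by case: (fE k). Qed.
Let E_S' k x : E k (E k.+1 x) = E k x.
Proof. exact: absorb_sym (E_S k) x. Qed.

Lemma chain_le k l x : (k <= l)%N -> E l (E k x) = E k x.
Proof.
move=> /subnK <-; elim: (l - k)%N x => [|n IH] x; first exact: iE.
by rewrite addSn -[in LHS]IH E_S IH.
Qed.

Let D k x := E k.+1 x - E k x.

Lemma chain_diff_sqr k x : nrm (D k x) ^+ 2 = re (inner x (E k.+1 x)) - re (inner x (E k x)).
Proof.
rewrite nrm_sqr /D (semiB isem) !(semiBl isem) !sE !iE E_S E_S'.
by rewrite subrr subr0 reD reN.
Qed.

Lemma chain_diff_sum n x : \sum_(k < n) nrm (D k x) ^+ 2 <= nrm x ^+ 2.
Proof.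
have -> : \sum_(k < n) nrm (D k x) ^+ 2 = re (inner x (E n x)) - re (inner x (E 0 x)).
  elim: n => [|n IH]; first by rewrite big_ord0 subrr.
  by rewrite big_ord_recr /= IH chain_diff_sqr addrC subrKA.
have e2 k : re (inner x (E k x)) = nrm (E k x) ^+ 2 by rewrite nrm_sqr sE iE.
rewrite !e2 (le_trans (y := nrm (E n x) ^+ 2)) ?gerBl ?sqr_ge0 //.
rewrite ler_pXn2r ?nnegrE ?nrm_ge0 //; exact: selfadj_idem_contr (sE n) (iE n) x.
Qed.

(** Cauchy-Schwarz for the [r.+1 ^ 2] orthogonal increments [D k x]. *)
Lemma chain_diff_sum1 r x : \sum_(k < r.+1 * r.+1) nrm (D k x) <= r.+1%:R * nrm x.
Proof.
have h := chain_diff_sum (r.+1 * r.+1) x.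
have := nrm_ge0 x; rewrite le_eqVlt => /orP[/eqP x0|xp].
  rewrite -x0 mulr0 big1 // => k _; apply/eqP; rewrite -sqrf_eq0 eq_le sqr_ge0 andbT.
  move: h; rewrite -x0 expr0n /= (bigD1 k) //=; apply: le_trans.
  by rewrite lerDl sumr_ge0 // => j _; rewrite sqr_ge0.
have r0 : (0 : R) < r.+1%:R by rewrite ltr0n.
(* The inequality of means, weighted to be sharp when the increments are equal. *)
have hk k : nrm (D k x) <= r.+1%:R / (2 * nrm x) * nrm (D k x) ^+ 2 + nrm x / (2 * r.+1%:R).
  rewrite -subr_ge0; set a := nrm (D k x); set X := nrm x in xp *; set s := r.+1%:R in r0 *.
  have -> : s / (2 * X) * a ^+ 2 + X / (2 * s) - a = (s * a - X) ^+ 2 / (2 * X * s).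
    by field; apply/andP; split; rewrite gt_eqF.
  by rewrite divr_ge0 ?sqr_ge0 // !mulr_ge0 // ltW.
apply: (@le_trans _ _ (\sum_(k < r.+1 * r.+1)
    (r.+1%:R / (2 * nrm x) * nrm (D k x) ^+ 2 + nrm x / (2 * r.+1%:R)))).
  by apply: ler_sum => k _; exact: hk.
rewrite big_split /= -mulr_sumr sumr_const card_ord.
have h2 := ler_wpM2l (_ : 0 <= r.+1%:R / (2 * nrm x)) h.
apply: (le_trans (lerD (h2 _) (lexx _))); first by rewrite divr_ge0 ?mulr_ge0 ?ltW.
rewrite -[X in _ + X]mulr_natr natrM le_eqVlt; apply/orP; left; apply/eqP.
by move: xp r0; set s := r.+1%:R; set X := nrm x => xp r0; field; apply/andP; split; rewrite gt_eqF.
Qed.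

(** The average of the chain: it decreases slowly along a filtration with
    respect to which every [T j] is tridiagonal. *)
Definition chain_avg (n : nat) (x : H) : H := (n%:R^-1 : R)%:C *: \sum_(k < n) E k x.

Lemma chain_avg_lin n : linear (chain_avg n).
Proof. by apply: lin_scale; apply: lin_bigsum => k; exact: lE. Qed.

Lemma chain_avg_selfadj n : selfadj (chain_avg n).
Proof.
move=> x y; rewrite /chain_avg (semiZ isem) (semiZl isem) conjc_real; congr (_ * _).
by rewrite (semi_sumr isem) (semi_suml isem); apply: eq_bigr => k _; rewrite sE.
Qed.

Lemma chain_avg_contr n : contr (chain_avg n.+1).
Proof.
move=> x; rewrite /chain_avg nrmZ cabs_real ger0_norm ?invr_ge0 // mulrC.
rewrite ler_pdivrMr ?ltr0n // (le_trans (nrm_sum _ _ _)) //.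
apply: (@le_trans _ _ (\sum_(k < n.+1) nrm x)).
  by apply: ler_sum => k _; exact: selfadj_idem_contr (sE k) (iE k) x.
by rewrite sumr_const card_ord mulr_natr.
Qed.

Lemma chain_avg_top n x : E n (chain_avg n x) = chain_avg n x.
Proof.
rewrite /chain_avg (linZ (lE n)) (lin_sum (lE n)); congr (_ *: _).
by apply: eq_bigr => k _; rewrite chain_le // ltnW.
Qed.

Lemma chain_avg_fix n v : E 0 v = v -> chain_avg n.+1 v = v.
Proof.
move=> v0; rewrite /chain_avg (eq_bigr (fun=> v)) => [|k _]; last by rewrite -[in LHS]v0 chain_le.
rewrite sumr_const card_ord -[v *+ _]scaler_nat scalerA -(rmorph_nat (real_complex R)) -rmorphM.
by rewrite mulVf ?scale1r // pnatr_eq0.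
Qed.

(** Since [T j] moves the chain by one step only, the commutator with the [k]-th
    projection is [E k T D k - D k T E k]; the increments [D k] are orthogonal and
    there are [r.+1 ^ 2] of them. *)
Lemma chain_avg_comm r j : comm_le (chain_avg (r.+1 * r.+1)) (T j) (2 / r.+1%:R).
Proof.
move=> x; set g := chain_avg _; set z := _ - _.
have key y : cabs (inner y z) <= 2 / r.+1%:R * nrm x * nrm y.
  have -> : inner y z = (((r.+1 * r.+1)%:R)^-1 : R)%:C *
      \sum_(k < r.+1 * r.+1) (inner (T j (E k y)) (D k x) - inner (D k y) (T j (E k x))).
    rewrite /z /g /chain_avg (linZ (lT j)) -scalerBr (semiZ isem); congr (_ * _).
    rewrite (lin_sum (lT j)) -sumrB (semi_sumr isem); apply: eq_bigr => k _.
    have f1 : inner (T j (E k y)) (E k.+1 x) = inner y (E k (T j x)).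
      by rewrite -sE T_E sT sE.
    have f2 : inner (E k.+1 y) (T j (E k x)) = inner y (T j (E k x)) by rewrite sE T_E.
    rewrite /D !(semiB isem) !(semiBl isem) f1 f2 sT.
    by rewrite opprB addrA subrK.
  rewrite /cabs normcM -!/(cabs _) cabs_real ger0_norm ?invr_ge0 //.
  rewrite mulrC ler_pdivrMr ?ltr0n //.
  have cabs_sum (I : Type) (s : seq I) (F : I -> R[i]) :
      cabs (\sum_(i <- s) F i) <= \sum_(i <- s) cabs (F i).
    elim/big_rec2: _ => [|i u w _ hh]; first by rewrite /cabs normc0.
    by rewrite (le_trans (le_normcD _ _)) // lerD2l.
  apply: (le_trans (cabs_sum _ _ _)).
  apply: (@le_trans _ _ (\sum_(k < r.+1 * r.+1) (nrm y * nrm (D k x) + nrm x * nrm (D k y)))).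
    apply: ler_sum => k _; rewrite (le_trans (le_normcD _ _)) // normcN -!/(cabs _).
    have cE u : nrm (E k u) <= nrm u by exact: selfadj_idem_contr (sE k) (iE k) u.
    rewrite lerD // (le_trans (inner_le _ _)) //.
      by rewrite ler_wpM2r ?nrm_ge0 // (le_trans (cT _ _)).
    by rewrite mulrC ler_wpM2r ?nrm_ge0 // (le_trans (cT _ _)).
  rewrite big_split /= -!mulr_sumr.
  have hx := ler_wpM2l (nrm_ge0 y) (chain_diff_sum1 r x).
  have hy := ler_wpM2l (nrm_ge0 x) (chain_diff_sum1 r y).
  apply: (le_trans (lerD hx hy)); rewrite natrM le_eqVlt; apply/orP; left; apply/eqP.
  by field; rewrite addrC natr1 pnatr_eq0.
have := key z; rewrite inner_selfE cabs_real ger0_norm ?sqr_ge0 // expr2.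
have := nrm_ge0 z; rewrite le_eqVlt => /orP[/eqP<- _|zp].
  by rewrite mulr_ge0 ?nrm_ge0 // divr_ge0.
by rewrite ler_pM2r.
Qed.

End Chain.

(** The range of [P] need not be nearly invariant under the [T j]: that [g] decreases
    gradually along a growing chain of spaces is what makes it nearly commute. *)
Lemma quasicentral_cutoff (J : finType) (T : J -> H -> H) (vs : seq H) (e : R) :
  (forall j, linear (T j)) -> (forall j, selfadj (T j)) -> (forall j, contr (T j)) ->
  0 < e ->
  exists g P, [/\ [/\ linear g, selfadj g & contr g],
    finite_rank_proj P, forall x, P (g x) = g x,
    forall v, v \in vs -> g v = v & forall j, comm_le g (T j) e].
Proof.
move=> lT sT cT e0.
have [P0 [fP0 _ hP0]] := finite_rank_proj_add_seq vs finite_rank_proj0.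
have /choice[nx hnx] : forall P, exists P', finite_rank_proj P ->
    [/\ finite_rank_proj P', forall x, P' (P x) = P x &
      forall j x, P' (T j (P x)) = T j (P x)].
  move=> P; have [fP|nP] := pselect (finite_rank_proj P).
    by have [P' hP'] := finite_rank_proj_step lT fP; exists P'.
  by exists P.
pose E k := iter k nx P0.
have fE k : finite_rank_proj (E k) by elim: k => // k /hnx[].
have E_S k x : E k.+1 (E k x) = E k x by have [_ + _] := hnx _ (fE k); apply.
have T_E k j x : E k.+1 (T j (E k x)) = T j (E k x).
  by have [_ _ +] := hnx _ (fE k); apply.
pose r := Num.truncn (2 / e); pose n := (r.+1 * r.+1)%N.
exists (chain_avg E n), (E n); split.
- split; first exact: chain_avg_lin.
    exact: chain_avg_selfadj.
  exact: chain_avg_contr.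
- exact: fE.
- by move=> x; apply: chain_avg_top.
- by move=> v vs_v; apply: chain_avg_fix => //; exact: hP0.
move=> j x; have := chain_avg_comm lT sT cT fE E_S T_E r j x.
move=> h; apply: (le_trans h); rewrite ler_wpM2r ?nrm_ge0 //.
rewrite ler_pdivrMr ?ltr0n // mulrC -ler_pdivrMr // ltW //; exact: truncnS_gt.
Qed.

End FiniteRank.

Section RangeSpace.
Variables (R : realType) (H : hilbertType R).
Local Notation isem := (@inner_semi R H).

(** Realized as the quotient of [H] by the kernel of [P]: the classes for the
    semi-inner product [<P x, P y>]. *)
Lemma range_space (P : H -> H) : finite_rank_proj P ->
  exists (K : hilbertType R) (q : H -> K) (io : K -> H),
  [/\ linear q /\ linear io, forall x, io (q x) = P x, forall h, q (io h) = h,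
      forall x y, inner (io x) (io y) = inner x y & finite_dim K].
Proof.
move=> [lP sP iP [N [e he]]].
pose f (x y : H) := inner (P x) (P y).
have sf : semi_inner f.
  split=> [z a x y|x y|x]; rewrite /f; first by rewrite lP (semi_lin isem).
    exact: innerC.
  by rewrite -nrm_sqr sqr_ge0.
have fE x : semi_norm f x = nrm (P x) by [].
have cf : fast_complete f.
  move=> u hu.
  have [l hl] : exists l, forall k, nrm (P (u k) - l) <= 1 / k.+1%:R.
    apply: hilbert_fast_cvg => i j; rewrite mul1r.
    by apply: le_trans (hu i j); rewrite fE (linB lP).
  have Pc := selfadj_idem_contr sP iP.
  exists l, 1 => k; rewrite fE (linB lP) -[P (u k)]iP -(linB lP).
  exact: le_trans (Pc _) (hl k).
have [K [q [lq qs qi]]] := hilbert_quotient sf cf.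
have /choice[r hr] : forall h, exists x, q x = h by [].
have q_eq x y : P x = P y -> q x = q y.
  move=> h; apply/eqP; rewrite -subr_eq0 -(linB lq); apply/eqP/nrm_le0.
  by rewrite /nrm /semi_norm qi /f (linB lP) h subrr (semi0 isem) sqrtr0.
have P_eq x y : q x = q y -> P x = P y.
  move=> h; apply/eqP; rewrite -subr_eq0 -(linB lP); apply/eqP/nrm_le0.
  by rewrite -fE /semi_norm -qi (linB lq) h subrr (semi0 (@inner_semi R K)) sqrtr0.
have qr x : P (r (q x)) = P x by apply: P_eq; rewrite hr.
exists K, q, (fun h => P (r h)); split.
- split=> // a x y; rewrite -lP; apply: P_eq.
  by rewrite lq !hr.
- by [].
- by move=> h; rewrite -[RHS]hr; apply: q_eq; rewrite iP.
- by move=> x y; rewrite -[RHS]/(inner x y) -{2}(hr x) -{2}(hr y) qi.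
exists N, (fun i => q (e i)) => h; have [c hc] := he (r h); exists c.
have -> : h = q (P (r h)) by rewrite -[LHS]hr; apply: q_eq; rewrite iP.
rewrite hc (lin_sum lq); apply: eq_bigr => i _; by rewrite (linZ lq).
Qed.

End RangeSpace.

Section Isometry.
Variables (R : realType) (n : nat).

Lemma linear_pack (H : hilbertType R) (T : 'cV[R[i]]_n -> H) : linear T ->
  exists V : {linear 'cV[R[i]]_n -> H}, forall v, V v = T v.
Proof.
move=> lT.
pose V : {linear 'cV[R[i]]_n -> H} := HB.pack T (GRing.isLinear.Build _ _ _ _ T lT).
by exists V.
Qed.

Lemma isometry_nrm (H : hilbertType R) (V : {linear 'cV[R[i]]_n -> H}) b :
  l2_isometry V -> nrm (V (delta_mx b 0)) = 1.
Proof.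
move=> iV; have := iV (delta_mx b 0).
rewrite (bigD1 b) //= big1 ?addr0 => [|a ab]; last first.
  by rewrite mxE (negbTE ab) normr0 expr0n.
rewrite mxE !eqxx normr1 expr1n norm_nrmE -rmorphXn => -[] /eqP.
by rewrite sqrp_eq1 ?nrm_ge0 // => /eqP.
Qed.

Lemma isometry_transport (H K : hilbertType R) (V : {linear 'cV[R[i]]_n -> H})
    (J : H -> K) : linear J -> (forall v, nrm (J (V v)) = nrm (V v)) -> l2_isometry V ->
  exists V' : {linear 'cV[R[i]]_n -> K}, l2_isometry V' /\ forall v, V' v = J (V v).
Proof.
move=> lJ nJ iV.
have [V' hV'] : exists V' : {linear 'cV[R[i]]_n -> K}, forall v, V' v = J (V v).
  by apply: (@linear_pack K (fun v => J (V v))) => a u v; rewrite linearP lJ.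
exists V'; split => // v.
by rewrite -(iV v) !norm_nrmE hV' nJ.
Qed.

Lemma compressionE (H : hilbertType R) (V : {linear 'cV[R[i]]_n -> H}) (T : H -> H) a b :
  compression V T a b = inner (V (delta_mx a 0)) (T (V (delta_mx b 0))).
Proof. by rewrite !mxE. Qed.

End Isometry.

Section Compression.
Variables (R : realType) (H : hilbertType R).
Local Notation isem := (@inner_semi R H).

Lemma comm_comp1 (S S' T : H -> H) (e e' : R) : linear S -> contr S -> contr S' -> 0 <= e ->
  comm_le S T e -> comm_le S' T e' -> comm_le (S \o S') T (e + e').
Proof.
move=> lS cS cS' e0 c c'.
by have := comm_comp lS (contr_obnd cS) (contr_obnd cS') ler01 e0 c c'; rewrite mulr1 mul1r.
Qed.

Section Cutoff.
Variable g : H -> H.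
Hypotheses (lg : linear g) (sg : selfadj g) (cg : contr g).

(** [g A g], with the defect [1 - g^2] added to make a POVM again when [b] marks
    exactly one outcome. *)
Definition cutoff (b : bool) (A : H -> H) (x : H) : H :=
  g (A (g x)) + (if b then x - g (g x) else 0).

Lemma cutoff_lin b A : linear A -> linear (cutoff b A).
Proof.
move=> lA; apply: lin_add; first by move=> a x y; rewrite lg lA lg.
case: b; last by move=> a x y; rewrite scaler0 addr0.
by apply: lin_sub => // a x y; rewrite !lg.
Qed.

Lemma cutoff_selfadj b A : selfadj A -> selfadj (cutoff b A).
Proof.
move=> sA x y; rewrite /cutoff (semiD isem) (semiDl isem) sg sA sg; congr (_ + _).
case: b; last by rewrite (semi0 isem) (semi0l isem).
by rewrite (semiB isem) (semiBl isem) !sg.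
Qed.

Lemma cutoff_ge0 b A x : psd A -> 0 <= re (inner x (cutoff b A x)).
Proof.
move=> pA; rewrite /cutoff (semiD isem) reD -sg addr_ge0 ?psd_re //.
case: b; last by rewrite (semi0 isem).
rewrite (semiB isem) -sg reD reN -!nrm_sqr subr_ge0.
by rewrite ler_pXn2r ?nnegrE ?nrm_ge0.
Qed.

Lemma cutoff_sum m (A : 'I_m -> H -> H) i0 x : povm A ->
  \sum_i cutoff (i == i0) (A i) x = x.
Proof.
move=> pA; rewrite big_split /= -(lin_sum lg) pA.2 -big_mkcond /= big_pred1_eq.
by rewrite addrC subrK.
Qed.

(** Every factor [g] can be moved at the cost [e]; after that, [A] and [B] commute
    exactly. *)
Lemma cutoff_comm b b' A B e : 0 <= e -> linear A -> linear B -> contr A -> contr B ->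
  comm_le g A e -> comm_le g B e -> (forall x, A (B x) = B (A x)) ->
  comm_le (cutoff b A) (cutoff b' B) (8 * e).
Proof.
move=> e0 lA lB cA cB gA gB AB.
have gg : comm_le g g 0 by move=> x; rewrite subrr nrm0 mul0r.
have BA0 : comm_le A B 0 by move=> x; rewrite AB subrr nrm0 mul0r.
have cG T : contr T -> contr (T \o g) by move=> cT x /=; rewrite (le_trans (cT _)).
have gg1 T e1 : 0 <= e1 -> comm_le g T e1 -> comm_le (g \o g) T (e1 + e1).
  by move=> h c; apply: comm_comp1.
have sandwich C T e1 e2 : contr C -> linear C -> 0 <= e1 -> 0 <= e2 -> comm_le g T e1 -> comm_le C T e2 ->
    comm_le (g \o (C \o g)) T (e1 + (e2 + e1)).
  by move=> cC lC h1 h2 c1 c2; apply: comm_comp1 => //; [exact: cG|exact: comm_comp1].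
have defect (c : bool) T e1 : linear T -> 0 <= e1 -> comm_le g T e1 ->
    comm_le (fun x => if c then x - g (g x) else 0) T (e1 + e1).
  move=> lT h gT; case: c; first exact: comm_id_sub (gg1 _ _ h gT).
  by move=> x; rewrite (lin0 lT) subrr nrm0 mulr_ge0 ?addr_ge0 ?nrm_ge0.
have g_cut : comm_le g (cutoff b' B) e.
  apply: comm_sym; have := comm_add lg (sandwich _ _ _ _ cB lB (lexx 0) e0 gg (comm_sym gB)) (defect b' _ _ lg (lexx 0) gg).
  by rewrite !addr0 add0r.
have A_cut : comm_le A (cutoff b' B) (4 * e).
  apply: comm_sym; have := comm_add lA (sandwich _ _ _ _ cB lB e0 (lexx 0) gA (comm_sym BA0)) (defect b' _ _ lA e0 gA).
  by rewrite (_ : _ + _ = 4 * e) //; ring.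
have e40 : 0 <= 4 * e by rewrite mulr_ge0.
have lc := cutoff_lin b' lB.
have := comm_add lc (sandwich _ _ _ _ cA lA e0 e40 g_cut A_cut) (defect b _ _ lc e0 g_cut).
by rewrite (_ : _ + _ = 8 * e) //; ring.
Qed.

(** Since [g] fixes [x] and [y], the defect terms vanish against them, and it
    remains to move two factors [g] through [B]. *)
Lemma cutoff_close b b' A B e x y : linear A -> linear B -> contr A -> comm_le g B e ->
  0 <= e -> g x = x -> g y = y ->
  cabs (inner x (cutoff b A (cutoff b' B y)) - inner x (A (B y))) <= 2 * e * (nrm x * nrm y).
Proof.
move=> lA lB cA gB e0 gx gy.
have hB : cutoff b' B y = g (B y).
  by rewrite /cutoff !gy subrr; case: b'; rewrite addr0.
have hA z : inner x (cutoff b A z) = inner x (A (g z)).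
  rewrite /cutoff (semiD isem) -sg gx.
  suff -> : inner x (if b then z - g (g z) else 0) = 0 by rewrite addr0.
  by case: b; rewrite ?(semi0 isem) // (semiB isem) -!sg !gx subrr.
rewrite hA hB -(semiB isem) -(linB lA) (le_trans (inner_le _ _)) //.
rewrite mulrCA ler_wpM2l ?nrm_ge0 // (le_trans (cA _)) //.
rewrite (le_trans (nrm_dist_triangle (g (B y)) _ _)) // -mulrA mulr_natl mulr2n lerD //.
  rewrite -(linB lg) (le_trans (cg _)) // -{2}gy; exact: gB.
by rewrite -{2}gy; exact: gB.
Qed.

End Cutoff.

Lemma finite_dim_approximation (n m d : nat) (V : {linear 'cV[R[i]]_n -> H})
    (A B : 'I_d -> 'I_m -> H -> H) (e : R) :
  (0 < m)%N -> 0 < e -> l2_isometry V -> (forall k, povm (A k)) -> (forall l, povm (B l)) ->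
  (forall k i l j x, A k i (B l j x) = B l j (A k i x)) ->
  exists (K : hilbertType R) (V' : {linear 'cV[R[i]]_n -> K}) (A' B' : 'I_d -> 'I_m -> K -> K),
  [/\ finite_dim K, l2_isometry V', (forall k, povm (A' k)) /\ (forall l, povm (B' l)),
    forall k i l j, comm_le (A' k i) (B' l j) e &
    forall k i l j a b, cabs (inner (V' (delta_mx a 0)) (A' k i (B' l j (V' (delta_mx b 0)))) -
      inner (V (delta_mx a 0)) (A k i (B l j (V (delta_mx b 0))))) <= e].
Proof.
move=> m0 e0 iV pA pB AB; pose i0 := Ordinal m0; pose e8 := e / 8.
have e80 : 0 < e8 by rewrite divr_gt0.
pose T (p : 'I_d * 'I_m + 'I_d * 'I_m) :=
  match p with inl (k, j) => A k j | inr (l, j) => B l j end.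
have [] := @quasicentral_cutoff R H ('I_d * 'I_m + 'I_d * 'I_m)%type T
  [seq V (delta_mx b 0) | b <- enum 'I_n] e8.
- by move=> [] [k j] /=; exact: povm_lin.
- by move=> [] [k j] /=; exact/psd_selfadj/povm_psd.
- by move=> [] [k j] /=; exact: povm_contr.
- by [].
move=> g [P [[lg sg cg] fP Pg gV gT]].
have [lP sP _ _] := fP.
have gP x : g (P x) = g x := absorb_sym sg sP Pg x.
have {}gV b : g (V (delta_mx b 0)) = V (delta_mx b 0).
  by apply: gV; apply/mapP; exists b; rewrite ?mem_enum.
have gA k j : comm_le g (A k j) e8 by exact: gT (inl (k, j)).
have gB l j : comm_le g (B l j) e8 by exact: gT (inr (l, j)).
have [K [q [io [[lq lio] ioq qio iio fK]]]] := range_space fP.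
have nio h : nrm (io h) = nrm h by rewrite /nrm /semi_norm iio.
have PV v : P (V v) = V v.
  rewrite [v]matrix_sum_delta linear_sum (lin_sum lP); apply: eq_bigr => a _.
  by rewrite big_ord1 linearZ /= (linZ lP) -gV Pg.
have Pio h : P (io h) = io h by rewrite -ioq qio.
have [V' [iV' V'E]] : exists V' : {linear 'cV[R[i]]_n -> K}, l2_isometry V' /\
    forall v, V' v = q (V v).
  by apply: isometry_transport => // v; rewrite -nio ioq PV.
have Pcut b C x : P (cutoff g b C (io x)) = cutoff g b C (io x).
  rewrite /cutoff (linD lP) Pg; congr (_ + _); case: b; last by rewrite (lin0 lP).
  by rewrite (linB lP) Pio Pg.
pose lift b C (h : K) := q (cutoff g b C (io h)).
have io_lift b C h : io (lift b C h) = cutoff g b C (io h) by rewrite /lift ioq Pcut.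
have lift_povm (C : 'I_m -> H -> H) : povm C -> povm (fun i => lift (i == i0) (C i)).
  move=> pC; split=> [i|x]; last first.
    by rewrite /lift -(lin_sum lq) (cutoff_sum lg) // qio.
  have pCi := povm_psd pC i; have lC := psd_lin pCi.
  have lc := cutoff_lin lg (i == i0) lC.
  apply: psd_intro.
  - by move=> a x y; rewrite /lift lio lc lq.
  - exists 3 => // x; rewrite -nio io_lift (le_trans (nrmD _ _)) // (_ : 3 * nrm x = nrm x + 2 * nrm x); last by ring.
    rewrite lerD // -?nio.
      by rewrite (le_trans (cg _)) // (le_trans (povm_contr pC _ _)).
    case: (i == i0); last by rewrite nrm0 mulr_ge0 ?nrm_ge0.
    by rewrite (le_trans (nrmB _ _)) // mulr_natl mulr2n lerD2l (le_trans (cg _)).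
  - move=> x y; rewrite -!iio !io_lift; apply: cutoff_selfadj => //.
    exact: psd_selfadj.
  - by move=> x; rewrite -iio io_lift cutoff_ge0.
exists K, V', (fun k i => lift (i == i0) (A k i)), (fun l j => lift (j == i0) (B l j)).
split=> //.
- by split=> k; exact: lift_povm.
- move=> k i l j h; rewrite -nio (linB lio) !io_lift.
  have -> : e = 8 * e8 by rewrite /e8; field.
  rewrite -(nio h); apply: cutoff_comm => //; rewrite ?ltW //.
  + exact: povm_lin. + exact: povm_lin. + exact: povm_contr. + exact: povm_contr.
- move=> k i l j a b; rewrite !V'E -iio !io_lift !ioq !PV.
  have h := @cutoff_close g lg sg cg (i == i0) (j == i0) (A k i) (B l j) e8
    (V (delta_mx a 0)) (V (delta_mx b 0)) (povm_lin (pA k) i) (povm_lin (pB l) j)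
    (povm_contr (pA k) i) (gB l j) (ltW e80) (gV a) (gV b).
  apply: (le_trans h); rewrite !isometry_nrm // !mulr1 /e8; lra.
Qed.

End Compression.

(** * Ultraproducts *)

Section Ultralimit.
Variables (R : realType) (U : set_system nat).
Hypothesis UU : UltraFilter U.
Implicit Types a b : nat -> R.

Definition bounded_real a := exists M : R, forall N, `|a N| <= M.
Definition ulim a : R := lim (a @ U).

Let UF : ProperFilter U. Proof. exact: ultra_proper. Qed.

Lemma ulim_cvg a : bounded_real a -> a @ U --> ulim a.
Proof.
move=> [M hM]; apply/cvg_ex.
have := @segment_compact R (- M) M; rewrite compact_ultra => /(_ (a @ U)).
have aU : UltraFilter (a @ U).
  split; first exact: fmap_proper_filter.
  move=> G PG aG; apply/seteqP; split => // S GS.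
  have [//|nS] := in_ultra_setVsetC (a @^-1` S) UU.
  have : G (~` S) by apply: aG.
  move=> GnS; have /filter_ex[x [Sx nSx]] := @filterI _ _ (@filter_filter _ _ PG) _ _ GS GnS.
  by [].
move=> /(_ aU) [|p [_ ap]]; last by exists p.
by apply: (@filterE _ U) => N /=; rewrite in_itv /= -ler_norml.
Qed.

Lemma ulim_eq a l : a @ U --> l -> ulim a = l.
Proof. by move=> h; apply: cvg_lim. Qed.

Lemma ulim_cst (c : R) : ulim (fun=> c) = c.
Proof. by apply: ulim_eq; exact: cvg_cst. Qed.

Lemma ulimD a b : bounded_real a -> bounded_real b ->
  ulim (fun N => a N + b N) = ulim a + ulim b.
Proof. by move=> /ulim_cvg ha /ulim_cvg hb; apply: ulim_eq; exact: cvgD. Qed.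

Lemma ulimM c a : bounded_real a -> ulim (fun N => c * a N) = c * ulim a.
Proof. by move=> /ulim_cvg ha; apply: ulim_eq; apply: cvgM ha; exact: cvg_cst. Qed.

Lemma ulimN a : bounded_real a -> ulim (fun N => - a N) = - ulim a.
Proof. by move=> /ulim_cvg ha; apply: ulim_eq; exact: cvgN. Qed.

Lemma ulim_le a (c : R) : bounded_real a -> U [set N | a N <= c] -> ulim a <= c.
Proof.
by move=> /ulim_cvg ha h; apply: limr_le => //; apply/cvg_ex; exists (ulim a).
Qed.

Lemma ulim_ge a (c : R) : bounded_real a -> U [set N | c <= a N] -> c <= ulim a.
Proof.
by move=> /ulim_cvg ha h; apply: limr_ge => //; apply/cvg_ex; exists (ulim a).
Qed.

Lemma ulim_lt a (c : R) : bounded_real a -> ulim a < c -> U [set N | a N < c].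
Proof.
move=> /ulim_cvg ha h; have d0 : 0 < c - ulim a by rewrite subr_gt0.
move/cvgrPdist_lt: ha => /(_ _ d0); apply: filterS => N /=.
by rewrite distrC => /(le_lt_trans (ler_norm _)); rewrite ltrD2r.
Qed.

End Ultralimit.

Section Ultraproduct.
Variables (R : realType) (H : nat -> hilbertType R) (U : set_system nat).
Hypothesis UU : UltraFilter U.
Hypothesis U_ge : forall k, U [set N | (k <= N)%N].

Record bseq := BSeq { bseq_val :> forall N, H N;
  bseq_bnd : exists M : R, forall N, nrm (bseq_val N) <= M }.
HB.instance Definition _ := gen_eqMixin bseq.
HB.instance Definition _ := gen_choiceMixin bseq.

Lemma bseq_eq (x y : bseq) : (forall N, x N = y N) -> x = y.
Proof.
case: x y => [x bx] [y yb] /= h.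
have xy : x = y by apply: functional_extensionality_dep.
by move: bx yb; rewrite xy => bx yb; congr BSeq; exact: Prop_irrelevance.
Qed.

Program Definition bseq0 : bseq := @BSeq (fun N => 0) _.
Next Obligation. by exists 0 => N; rewrite nrm0. Qed.
Program Definition bseqD (x y : bseq) : bseq := @BSeq (fun N => x N + y N) _.
Next Obligation.
move=> [x [Mx hx]] [y [My hy]]; exists (Mx + My) => N /=.
by rewrite (le_trans (nrmD _ _)) // lerD.
Qed.
Program Definition bseqN (x : bseq) : bseq := @BSeq (fun N => - x N) _.
Next Obligation. by move=> [x [M hx]]; exists M => N /=; rewrite nrmN. Qed.
Program Definition bseqZ (a : R[i]) (x : bseq) : bseq := @BSeq (fun N => a *: x N) _.
Next Obligation.
by move=> a [x [M hx]]; exists (cabs a * M) => N /=; rewrite nrmZ ler_wpM2l ?cabs_ge0.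
Qed.

Lemma bseqDA : associative bseqD.
Proof. by move=> x y z; apply: bseq_eq => N /=; rewrite addrA. Qed.
Lemma bseqDC : commutative bseqD.
Proof. by move=> x y; apply: bseq_eq => N /=; rewrite addrC. Qed.
Lemma bseq0D : left_id bseq0 bseqD.
Proof. by move=> x; apply: bseq_eq => N /=; rewrite add0r. Qed.
Lemma bseqND : left_inverse bseq0 bseqN bseqD.
Proof. by move=> x; apply: bseq_eq => N /=; rewrite addNr. Qed.
HB.instance Definition _ := GRing.isZmodule.Build bseq bseqDA bseqDC bseq0D bseqND.
Lemma bseqZA a b x : bseqZ a (bseqZ b x) = bseqZ (a * b) x.
Proof. by apply: bseq_eq => N /=; rewrite scalerA. Qed.
Lemma bseq1Z : left_id 1 bseqZ.
Proof. by move=> x; apply: bseq_eq => N /=; rewrite scale1r. Qed.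
Lemma bseqZDr : right_distributive bseqZ +%R.
Proof. by move=> a x y; apply: bseq_eq => N /=; rewrite scalerDr. Qed.
Lemma bseqZDl x : {morph bseqZ^~ x : a b / a + b}.
Proof. by move=> a b; apply: bseq_eq => N /=; rewrite scalerDl. Qed.
HB.instance Definition _ := GRing.Zmodule_isLmodule.Build R[i] bseq
  bseqZA bseq1Z bseqZDr bseqZDl.

Definition uform (x y : bseq) : R[i] :=
  (ulim U (fun N => re (inner (x N) (y N)))) +i* (ulim U (fun N => im (inner (x N) (y N)))).

Lemma inner_bnd (x y : bseq) : exists M : R, forall N, cabs (inner (x N) (y N)) <= M.
Proof.
case: x y => x [M hx] [y [M' hy]]; exists (M * M') => N.
by rewrite (le_trans (inner_le _ _)) // ler_pM ?nrm_ge0.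
Qed.

Lemma re_bnd (x y : bseq) : bounded_real (fun N => re (inner (x N) (y N))).
Proof.
by have [M hM] := inner_bnd x y; exists M => N; rewrite (le_trans (re_le_cabs _)).
Qed.
Lemma im_bnd (x y : bseq) : bounded_real (fun N => im (inner (x N) (y N))).
Proof.
by have [M hM] := inner_bnd x y; exists M => N; rewrite (le_trans (im_le_cabs _)).
Qed.
Lemma bndM c a : bounded_real a -> bounded_real (fun N => c * a N : R).
Proof. by move=> [M hM]; exists (`|c| * M) => N; rewrite normrM ler_wpM2l. Qed.
Lemma bndN a : bounded_real a -> bounded_real (fun N => - a N : R).
Proof. by move=> [M hM]; exists M => N; rewrite normrN. Qed.
Lemma bndD a b : bounded_real a -> bounded_real b -> bounded_real (fun N => a N + b N : R).
Proof.
move=> [M hM] [M' hM']; exists (M + M') => N.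
by rewrite (le_trans (ler_normD _ _)) // lerD.
Qed.

Lemma uform_semi : semi_inner uform.
Proof.
split=> [z a x y|x y|x].
- have bR := re_bnd z x; have bI := im_bnd z x.
  apply: complex_eqP; rewrite !(cplxE R) /= -!(ulimM UU _ bR) -!(ulimM UU _ bI).
    rewrite -(ulimN UU (bndM _ bI)) -(ulimD UU (bndM _ bR) (bndN (bndM _ bI))).
    rewrite -(ulimD UU (bndD (bndM _ bR) (bndN (bndM _ bI))) (re_bnd z y)).
    congr ulim; apply/funext => N.
    by rewrite (semi_lin (@inner_semi _ _)) !(cplxE R).
  rewrite -(ulimD UU (bndM _ bI) (bndM _ bR)).
  rewrite -(ulimD UU (bndD (bndM _ bI) (bndM _ bR)) (im_bnd z y)).
  congr ulim; apply/funext => N.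
  by rewrite (semi_lin (@inner_semi _ _)) !(cplxE R).
- apply: complex_eqP; rewrite !(cplxE R) /=.
    by congr ulim; apply/funext => N; rewrite innerC (cplxE R).
  rewrite -(ulimN UU (im_bnd y x)).
  by congr ulim; apply/funext => N; rewrite innerC (cplxE R).
- change (0 <= ulim U (fun N => re (inner (x N) (x N)))).
  apply: ulim_ge => //; first exact: re_bnd.
  by apply: (@filterE _ _ (ultra_proper)) => N /=; rewrite -nrm_sqr sqr_ge0.
Qed.

Lemma uform_lt (x : bseq) c : semi_norm uform x < c -> U [set N | nrm (x N) < c].
Proof.
move=> h; have c0 : 0 <= c by apply: le_trans (semi_norm_ge0 uform x) (ltW h).
have : semi_norm uform x ^+ 2 < c ^+ 2 by rewrite ltr_pXn2r ?nnegrE ?semi_norm_ge0.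
rewrite (semi_norm_sqr uform_semi) => /(ulim_lt UU (re_bnd x x)).
apply: (@filterS _ _ (@filter_filter _ _ (ultra_proper))) => N /=.
by rewrite -nrm_sqr ltr_pXn2r ?nnegrE ?nrm_ge0.
Qed.

Lemma uform_le (x : bseq) c : U [set N | nrm (x N) <= c] -> 0 <= c -> semi_norm uform x <= c.
Proof.
move=> h c0; rewrite -(ler_pXn2r (n := 2)) ?nnegrE ?semi_norm_ge0 //.
rewrite (semi_norm_sqr uform_semi); apply: ulim_le => //; first exact: re_bnd.
apply: (@filterS _ _ (@filter_filter _ _ (ultra_proper))) h => N /= h.
by rewrite -nrm_sqr ler_pXn2r ?nnegrE ?nrm_ge0.
Qed.

(** The limit of a fast Cauchy sequence of classes is diagonal: in position [N]
    it uses the last term, among the first [N], that is close to its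
    predecessors there. *)
Lemma uform_complete : fast_complete uform.
Proof.
have UF : ProperFilter U by exact: ultra_proper.
move=> u hu; pose w (k : nat) : R := k.+1%:R^-1.
have w0 k : 0 < w k by rewrite invr_gt0 ltr0n.
have w_le i j : (i <= j)%N -> w j <= w i by move=> ij; rewrite lef_pV2 ?posrE ?ltr0n // ler_nat.
pose close N i j := nrm (u i N - u j N) < 2 * (w i + w j).
have Uclose i j : U [set N | close N i j].
  have : semi_norm uform (u i - u j) < 2 * (w i + w j).
    apply: le_lt_trans (hu i j) _; rewrite -/(w i) -/(w j).
    by have := addr_gt0 (w0 i) (w0 j); move: (w i) (w j) => s t; lra.
  by move/uform_lt.
pose good N k := (k <= N)%N && [forall i : 'I_k.+1, close N i k].
have good0 N : good N 0%N.
  rewrite /good leq0n; apply/forallP => i; rewrite (ord1 i) /close subrr nrm0.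
  by rewrite mulr_gt0 // addr_gt0.
have /choice[ka hka] : forall N, exists k, good N k /\ forall j, good N j -> (j <= k)%N.
  move=> N; have ex : exists k, good N k by exists 0%N.
  have bd k : good N k -> (k <= N)%N by case/andP.
  by case: (ex_maxnP ex bd) => k; exists k.
have ka_close N i : (i <= ka N)%N -> close N i (ka N).
  have [/andP[_ /forallP h] _] := hka N; rewrite -ltnS => ik.
  exact: h (Ordinal ik).
have lb : exists M : R, forall N, nrm (u (ka N) N) <= M.
  have [M hM] := bseq_bnd (u 0%N); exists (4 + M) => N.
  have := ka_close N 0%N (leq0n _); rewrite /close nrm_distC => h.
  rewrite -[u (ka N) N](subrK (u 0%N N)) (le_trans (nrmD _ _)) // lerD // ltW //.
  apply: lt_le_trans h _; have := w_le 0%N (ka N) (leq0n _).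
  have w1 : w 0%N = 1 by rewrite /w invr1.
  by rewrite w1; move: (w (ka N)) => t; lra.
exists (BSeq lb), 4 => i; apply: uform_le; last by rewrite divr_ge0.
have : U [set N | forall j : 'I_i.+1, close N j i].
  by apply: filter_forall => j; exact: Uclose.
have := U_ge i; apply: filterS2 => N /= iN gN.
have ik : (i <= ka N)%N.
  by apply: (hka N).2; rewrite /good iN; apply/forallP.
apply: ltW; apply: lt_le_trans (ka_close N i ik) _.
by have := w_le _ _ ik; rewrite -/(w i); move: (w i) (w (ka N)) => s t; lra.
Qed.

Lemma ultraproduct : exists (K : hilbertType R) (q : bseq -> K),
  [/\ linear q, forall h, exists x, q x = h & forall x y, inner (q x) (q y) = uform x y].
Proof. exact: hilbert_quotient uform_semi uform_complete. Qed.

End Ultraproduct.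

Section UltraOperators.
Variables (R : realType) (H : nat -> hilbertType R) (U : set_system nat).
Hypothesis UU : UltraFilter U.
Hypothesis U_ge : forall k, U [set N | (k <= N)%N].
Let UF : ProperFilter U. Proof. exact: ultra_proper. Qed.

Variables (K : hilbertType R) (q : bseq H -> K).
Hypotheses (lq : linear q) (sq : forall h, exists x, q x = h)
  (iq : forall x y, inner (q x) (q y) = uform U x y).

Lemma ulim_close (a : nat -> R) (l : R) : bounded_real a ->
  (forall N, `|a N - l| <= N.+1%:R^-1) -> ulim U a = l.
Proof.
move=> ba h; apply/eqP; rewrite eq_le; apply/andP; split.
  apply: (@arch_le _ _ _ 1) => k; apply: ulim_le => //.
  have := U_ge k; apply: filterS => N /= kN.
  rewrite -lerBlDl (le_trans (ler_norm _)) // (le_trans (h N)) // div1r.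
  by rewrite lef_pV2 ?posrE ?ltr0n // ler_nat.
apply: (@arch_le _ _ _ 1) => k; rewrite -lerBlDr; apply: ulim_ge => //.
have := U_ge k; apply: filterS => N /= kN.
rewrite lerBlDr -lerBlDl (le_trans (ler_norm _)) // distrC (le_trans (h N)) // div1r.
by rewrite lef_pV2 ?posrE ?ltr0n // ler_nat.
Qed.

Lemma nrm_class (x : bseq H) : nrm (q x) = semi_norm (uform U) x.
Proof. by rewrite /nrm /semi_norm iq. Qed.

(** Classes agree as soon as representatives are arbitrarily close for
    [U]-almost every index. *)
Lemma class_eq (x y : bseq H) :
  (forall k : nat, U [set N | nrm (x N - y N) <= k.+1%:R^-1]) -> q x = q y.
Proof.
move=> h; apply/eqP; rewrite -subr_eq0 -(linB lq); apply/eqP/(@nrm_arch0 _ _ _ 1) => k.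
by rewrite nrm_class; apply: uform_le => //; rewrite div1r.
Qed.

Lemma class_eq_near (x y : bseq H) (c : R) : 0 < c -> q x = q y ->
  U [set N | nrm (x N - y N) < c].
Proof.
move=> c0 h; have : semi_norm (uform U) (x - y) < c.
  by rewrite -nrm_class (linB lq) h subrr nrm0.
by move/(uform_lt UU).
Qed.

Section OneOperator.
Variable T : forall N, H N -> H N.
Hypotheses (lT : forall N, linear (@T N)) (cT : forall N, contr (@T N)).

Lemma apply_seq_bnd (x : bseq H) : exists M : R, forall N, nrm (T (x N)) <= M.
Proof. by have [M hM] := bseq_bnd x; exists M => N; exact: le_trans (cT _) (hM N). Qed.

Definition apply_seq (x : bseq H) : bseq H := BSeq (apply_seq_bnd x).

Lemma apply_seq_lin : linear apply_seq.
Proof. by move=> a x y; apply: bseq_eq => N /=; rewrite lT. Qed.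

Lemma ultra_operator : exists L : K -> K,
  [/\ linear L, contr L & forall x, L (q x) = q (apply_seq x)].
Proof.
have /choice[r hr] : forall h, exists x, q x = h by [].
have LE x : q (apply_seq (r (q x))) = q (apply_seq x).
  apply: class_eq => k; have k0 : (0 : R) < k.+1%:R^-1 by rewrite invr_gt0 ltr0n.
  have := class_eq_near k0 (hr (q x)); apply: filterS => N /= h.
  by rewrite -(linB (@lT N)) (le_trans (cT _)) // ltW.
exists (fun h => q (apply_seq (r h))); split => // [a h h'|h].
  rewrite -{1}(hr h) -{1}(hr h') -lq LE apply_seq_lin lq //.
rewrite -{2}(hr h) !nrm_class; apply: (@arch_le _ _ _ 1) => k.
apply: uform_le => //; last by rewrite addr_ge0 ?semi_norm_ge0 ?divr_ge0.
have : semi_norm (uform U) (r h) < semi_norm (uform U) (r h) + 1 / k.+1%:R.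
  by rewrite ltrDl divr_gt0 // ltr0n.
by move/(uform_lt UU); apply: filterS => N /= /ltW /(le_trans (cT _)).
Qed.

End OneOperator.

Lemma uform_ge0 (x y : bseq H) : (forall N, 0 <= inner (x N) (y N)) -> 0 <= uform U x y.
Proof.
move=> h; rewrite ge0_complexE; apply/andP; split.
  apply/eqP; rewrite -(@ulim_cst _ _ UU 0); congr ulim; apply/funext => N.
  by have := h N; rewrite ge0_complexE => /andP[/eqP].
apply: (ulim_ge UU (re_bnd x y)); apply: filterE => N /=.
by have := h N; rewrite ge0_complexE => /andP[].
Qed.

Lemma ultra_psd (T : forall N, H N -> H N) (cT : forall N, contr (@T N)) (L : K -> K) :
  (forall N, psd (@T N)) -> linear L -> contr L ->
  (forall x, L (q x) = q (apply_seq cT x)) -> psd L.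
Proof.
move=> pT lL cL LE; split; first exact: contr_bounded.
move=> h; have [x <-] := sq h; rewrite LE iq; apply: uform_ge0 => N /=.
by case: (pT N).
Qed.

Lemma bseq_sum (I : Type) (s : seq I) (F : I -> bseq H) N :
  (\sum_(i <- s) F i) N = \sum_(i <- s) F i N.
Proof. by apply: (big_morph (fun x : bseq H => x N)). Qed.

Lemma ultra_povm m (A : forall N, 'I_m -> H N -> H N) (cA : forall i N, contr (A N i)) :
  (forall N, povm (A N)) ->
  exists L : 'I_m -> K -> K, povm L /\ forall i x, L i (q x) = q (apply_seq (cA i) x).
Proof.
move=> pA.
have /choice[L hL] : forall i, exists L : K -> K,
    [/\ linear L, contr L & forall x, L (q x) = q (apply_seq (cA i) x)].
  by move=> i; apply: ultra_operator => N; exact: povm_lin.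
exists L; split; last by move=> i; have [] := hL i.
split=> [k|h].
  have [lL cL LE] := hL k; apply: (@ultra_psd _ (cA k)) => // N.
  exact: povm_psd.
have [x <-] := sq h.
under eq_bigr => i _ do (have [_ _ ->] := hL i).
rewrite -(lin_sum lq); congr q; apply: bseq_eq => N.
by rewrite bseq_sum /= (pA N).2.
Qed.

(** A commutator bound tending to [0] with the index becomes exact commutation. *)
Lemma ultra_commute (S T : forall N, H N -> H N) (cS : forall N, contr (@S N))
    (cT : forall N, contr (@T N)) x :
  (forall N, comm_le (@S N) (@T N) N.+1%:R^-1) ->
  q (apply_seq cS (apply_seq cT x)) = q (apply_seq cT (apply_seq cS x)).
Proof.
move=> c; apply: class_eq => k; have [M hM] := bseq_bnd x.
pose n := Num.truncn (M * k.+1%:R).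
have := U_ge n; apply: filterS => N /= nN.
apply: (le_trans (c N (x N))).
apply: (@le_trans _ _ (N.+1%:R^-1 * M)); first by rewrite ler_wpM2l ?invr_ge0.
rewrite mulrC ler_pdivrMr ?ltr0n // mulrC -ler_pdivrMr ?invr_gt0 ?ltr0n // invrK.
apply: ltW; apply: lt_le_trans (truncnS_gt _) _.
by rewrite ler_nat ltnS.
Qed.

End UltraOperators.

(** * Approximate models of correlation arrays *)

Section Models.
Variables (R : realType) (m d n : nat).

(** The common ground of the three kinds of arrays: ordinary products in place of
    [bullet], no projections, and the same error for commutators and entries. *)
Definition approx_model (X : corr_array R m d n) (e : R) : Prop :=
  exists (H : hilbertType R) (V : {linear 'cV[R[i]]_n -> H}) (A B : 'I_d -> 'I_m -> H -> H),
  [/\ finite_dim H, l2_isometry V, (forall k, povm (A k)) /\ (forall l, povm (B l)),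
    forall k i l j, comm_le (A k i) (B l j) e &
    forall k i l j a b, cabs (inner (V (delta_mx a 0)) (A k i (B l j (V (delta_mx b 0)))) -
      (X (mxvec_index k i) (mxvec_index l j) a b : R[i])) <= e].

(** The data of a model bundled as one type, of which sequences can be chosen. *)
Record model := Model { mod_space : hilbertType R;
  mod_V : {linear 'cV[R[i]]_n -> mod_space};
  mod_A : 'I_d -> 'I_m -> mod_space -> mod_space;
  mod_B : 'I_d -> 'I_m -> mod_space -> mod_space }.

(** In the ultraproduct of models with errors [1 / N.+1], the commutators and the
    deviations from [X] vanish. *)
Lemma Qcn_of_approx (X : corr_array R m d n) :
  (forall e, 0 < e -> approx_model X e) -> Qcn R m d n X.
Proof.
move=> hX.
have /choice[M hM] : forall N : nat, exists M : model,
  [/\ l2_isometry (mod_V M), (forall k, povm (@mod_A M k)) /\ (forall l, povm (@mod_B M l)),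
    forall k i l j, comm_le (@mod_A M k i) (@mod_B M l j) N.+1%:R^-1 &
    forall k i l j a b, cabs (inner (mod_V M (delta_mx a 0))
        (@mod_A M k i (@mod_B M l j (mod_V M (delta_mx b 0)))) -
      (X (mxvec_index k i) (mxvec_index l j) a b : R[i])) <= N.+1%:R^-1].
  move=> N; have [|H [V [A [B [_ h1 h2 h3 h4]]]]] := hX N.+1%:R^-1.
    by rewrite invr_gt0 ltr0n.
  by exists (Model V A B).
pose H N := mod_space (M N).
have iV N : l2_isometry (mod_V (M N)) by case: (hM N).
have pA N k : povm (@mod_A (M N) k) by have [_ [+ _] _ _] := hM N; apply.
have pB N l : povm (@mod_B (M N) l) by have [_ [_ +] _ _] := hM N; apply.
have [U [UU oU]] := @ultraFilterLemma nat (\oo)%classic _.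
have U_ge k : U [set N | (k <= N)%N] by apply: oU; exists k.
have [K [q [lq sq iq]]] := @ultraproduct R H U UU U_ge.
have nV v N : nrm (mod_V (M N) v) = nrm (mod_V (M 0) v).
  apply/eqP; rewrite -(eqrXn2 (n := 2)) ?nrm_ge0 //; apply/eqP.
  have : `|mod_V (M N) v| ^+ 2 = `|mod_V (M 0) v| ^+ 2 by rewrite !iV.
  by rewrite !norm_nrmE -!rmorphXn => -[].
have Vb v : exists c : R, forall N, nrm (mod_V (M N) v : H N) <= c.
  by exists (nrm (mod_V (M 0) v)) => N; rewrite nV.
pose Vs v : bseq H := BSeq (Vb v).
have [V VE] : exists V : {linear 'cV[R[i]]_n -> K}, forall v, V v = q (Vs v).
  apply: linear_pack => a u v; rewrite -lq; congr q; apply: bseq_eq => N /=.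
  by rewrite linearP.
have cA k i N : contr (@mod_A (M N) k i) by exact: povm_contr (pA N k) i.
have cB l j N : contr (@mod_B (M N) l j) by exact: povm_contr (pB N l) j.
have /choice[A hA'] : forall k, exists L : 'I_m -> K -> K,
    povm L /\ forall i x, L i (q x) = q (apply_seq (H := H) (cA k i) x).
  by move=> k; apply: (ultra_povm UU lq sq iq (A := fun N => @mod_A (M N) k)) => N; exact: pA.
have /choice[B hB'] : forall l, exists L : 'I_m -> K -> K,
    povm L /\ forall i x, L i (q x) = q (apply_seq (H := H) (cB l i) x).
  by move=> l; apply: (ultra_povm UU lq sq iq (A := fun N => @mod_B (M N) l)) => N; exact: pB.
have AE k i x : A k i (q x) = q (apply_seq (H := H) (cA k i) x) by case: (hA' k).
have BE l j x : B l j (q x) = q (apply_seq (H := H) (cB l j) x) by case: (hB' l).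
exists K, V, A, B; split.
- move=> v; rewrite -(iV 0%N v) !norm_nrmE VE (nrm_class iq).
  congr (_%:C ^+ 2); apply/eqP; rewrite -(eqrXn2 (n := 2)) ?nrm_ge0 ?semi_norm_ge0 //.
  rewrite (semi_norm_sqr (uform_semi _ UU)); apply/eqP.
  rewrite -[RHS](@ulim_cst _ _ UU); congr ulim; apply/funext => N /=.
  by rewrite -nrm_sqr; congr (_ ^+ 2); exact: nV.
- by move=> k; case: (hA' k).
- by move=> l; case: (hB' l).
- move=> k i l j h; have [x <-] := sq h; rewrite /commutator BE !AE BE.
  rewrite (ultra_commute UU U_ge lq iq (cA k i) (cB l j)) ?subrr // => N.
  by case: (hM N).
- move=> k i l j; apply/matrixP => a b; rewrite compressionE /= !VE BE AE iq.
  pose E N := inner (mod_V (M N) (delta_mx a 0))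
    (mod_A k i (mod_B l j (mod_V (M N) (delta_mx b 0)))).
  have EX N : cabs (E N - (X (mxvec_index k i) (mxvec_index l j) a b : R[i])) <= N.+1%:R^-1.
    by have [_ _ _ hX'] := hM N; exact: hX'.
  have Eb := re_bnd (H := H) (Vs (delta_mx a 0))
    (apply_seq (H := H) (cA k i) (apply_seq (H := H) (cB l j) (Vs (delta_mx b 0)))).
  have Ei := im_bnd (H := H) (Vs (delta_mx a 0))
    (apply_seq (H := H) (cA k i) (apply_seq (H := H) (cB l j) (Vs (delta_mx b 0)))).
  apply: complex_eqP.
    apply/esym/(ulim_close UU U_ge Eb) => N; apply: le_trans (EX N).
    by rewrite -reN -reD; exact: re_le_cabs.
  apply/esym/(ulim_close UU U_ge Ei) => N; apply: le_trans (EX N).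
  by rewrite -imN -imD; exact: im_le_cabs.
Qed.

End Models.

Section Correlations.
Variables (R : realType) (m d : nat).

Lemma closure_corrP n (S : set (corr_array R m d n)) X :
  closure S X <-> forall e : R, 0 < e -> exists2 Y, S Y &
    forall k i l j a b, cabs ((Y (mxvec_index k i) (mxvec_index l j) a b : R[i]) -
      X (mxvec_index k i) (mxvec_index l j) a b) <= e.
Proof.
split=> [cX e e0|h B].
  have nX : nbhs X (ball X e%:C) by apply: nbhsx_ballx; rewrite ltcR.
  have [Y [SY [_ XY]]] := cX _ nX; exists Y => // k i l j a b.
  have [_ /(_ a b)] := XY (mxvec_index k i) (mxvec_index l j).
  rewrite -ball_normE /ball_ /= distrC cabs_normE ltcR => /ltW; exact.
move=> /nbhs_ballP[e /= e0 eB].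
have eE : e = (re e)%:C.
  by move: e0; rewrite ltcE /= => /andP[/eqP e0 _]; apply: complex_eqP.
have ree0 : 0 < re e by move: e0; rewrite eE ltcR.
have [|Y SY XY] := h (re e / 2); first by rewrite divr_gt0.
exists Y; split => //; apply: eB; split => // r s; split => // a b.
case/mxvec_indexP: r => k i; case/mxvec_indexP: s => l j.
rewrite -ball_normE /ball_ /= distrC cabs_normE eE ltcR.
by apply: le_lt_trans (XY k i l j a b) _; move: ree0; move: (re e) => t; lra.
Qed.

Lemma array_of_blocks n (x : 'I_d -> 'I_m -> 'I_d -> 'I_m -> 'M[R[i]^o]_n) :
  exists X : corr_array R m d n, has_blocks X x.
Proof.
have [g gK _] := curry_mxvec_bij d m.
exists (\matrix_(r, s) x (g r).1 (g r).2 (g s).1 (g s).2) => k i l j.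
by rewrite mxE -[mxvec_index k i]/(uncurry (@mxvec_index d m) (k, i)) -[mxvec_index l j]/(uncurry (@mxvec_index d m) (l, j)) !gK.
Qed.

Lemma approx_of_Qcn n (X : corr_array R m d n) (e : R) :
  (0 < m)%N -> 0 < e -> Qcn R m d n X -> approx_model X e.
Proof.
move=> m0 e0 [H [V [A [B [iV pA pB cAB hX]]]]].
have AB k i l j x : A k i (B l j x) = B l j (A k i x).
  by apply/eqP; rewrite -subr_eq0; apply/eqP; exact: cAB.
have [K [V' [A' [B' [fK iV' pAB cm cl]]]]] :=
  finite_dim_approximation m0 e0 iV pA pB AB.
exists K, V', A', B'; split => // k i l j a b.
by rewrite hX compressionE; exact: cl.
Qed.

Lemma approx_near n (X Y : corr_array R m d n) (e e' : R) :
  (forall k i l j a b, cabs ((Y (mxvec_index k i) (mxvec_index l j) a b : R[i]) -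
      X (mxvec_index k i) (mxvec_index l j) a b) <= e') ->
  0 <= e' -> approx_model Y e -> approx_model X (e + e').
Proof.
move=> XY e'0 [H [V [A [B [fH iV pAB cm cl]]]]]; exists H, V, A, B; split => //.
  move=> k i l j x; rewrite (le_trans (cm _ _ _ _ _)) // ler_wpM2r ?nrm_ge0 //.
  by rewrite lerDl.
move=> k i l j a b; rewrite -[X in cabs (X - _)](subrK (Y (mxvec_index k i) (mxvec_index l j) a b : R[i])).
rewrite -addrA (le_trans (le_normcD _ _)) // lerD //; [exact: cl|exact: XY].
Qed.

Lemma opnorm_comm_le (H : hilbertType R) (S T : H -> H) (e : R) : linear S -> contr S ->
  linear T -> contr T -> opnorm (commutator S T) <= e -> comm_le S T e.
Proof.
move=> lS cS lT cT h x.
have b : bounded_op (commutator S T).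
  apply/bounded_opP; split.
    by apply: lin_sub => a u v /=; rewrite ?lT ?lS ?lT.
  exists 2 => // y; rewrite /commutator (le_trans (nrmB _ _)) // mulr_natl mulr2n.
  by rewrite lerD // ?(le_trans (cS _)) // (le_trans (cT _)).
by rewrite (le_trans (opnorm_obnd b x)) // ler_wpM2r ?nrm_ge0.
Qed.

Lemma sqrt_modulus_mono k (e e' : R) : e <= e' -> sqrt_modulus k e <= sqrt_modulus k e'.
Proof. by move=> h; rewrite lerD2r ler_wpM2l // divr_ge0. Qed.

Lemma approx_of_Qepsn n (X : corr_array R m d n) (e : R) : 0 < e ->
  (forall eps, 0 < eps -> Qepsn R m d eps n X) -> approx_model X e.
Proof.
move=> e0 hX; have e20 : 0 < e / 2 by rewrite divr_gt0.
have [k [e1 [e10 he1]]] := sqrt_modulus_lt e20.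
pose e2 := Num.min e1 (e / 2).
have e2pos : 0 < e2 by rewrite lt_min e10 e20.
have [Y [H [V [A [B [fH [iV pA pB cm hY]]]]]] XY] := (closure_corrP _ _).1 (hX _ e2pos) _ e20.
have cAB p i l j : comm_le (A p i) (B l j) e2.
  apply: opnorm_comm_le (cm _ _ _ _); [exact: povm_lin|exact: povm_contr|exact: povm_lin|exact: povm_contr].
have -> : e = e / 2 + e / 2 by field.
apply: approx_near XY (ltW e20) _; exists H, V, A, B; split => //.
  move=> p i l j x; rewrite (le_trans (cAB _ _ _ _ _)) // ler_wpM2r ?nrm_ge0 //.
  by rewrite ge_min lexx orbT.
move=> p i l j a b; rewrite hY compressionE -(semiB (@inner_semi _ H)).
rewrite (le_trans (inner_le _ _)) // isometry_nrm // mul1r nrm_distC.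
have := bullet_close k (povm_effect i (pA p)) (povm_effect j (pB l)) (ltW e2pos) (cAB p i l j) (V (delta_mx b 0)).
rewrite isometry_nrm // mulr1 => h; apply: (le_trans h).
by apply: le_trans (ltW he1); apply: sqrt_modulus_mono; rewrite ge_min lexx.
Qed.

Lemma Pepsn_sub n (eps : R) : Pepsn R m d eps n `<=` Qepsn R m d eps n.
Proof.
apply: closure_subset => X [H [V [P [Q [fH [iV pP pQ cm hX]]]]]].
by exists H, V, P, Q; split => //; split => // k; [have [] := pP k|have [] := pQ k].
Qed.

(** The dilation is applied to [A], which amplifies [B], and then to the amplified
    [B], which amplifies the dilated [A]. Compressing back along both embeddings
    returns [A B] unchanged ([entry]). *)
Lemma Pepsn_of_approx n (X : corr_array R m d n) (eps : R) : (0 < m)%N -> 0 < eps ->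
  (forall e, 0 < e -> approx_model X e) -> Pepsn R m d eps n X.
Proof.
move=> m0 eps0 hX; apply/closure_corrP => e e0.
have e20 : 0 < e / 2 by rewrite divr_gt0.
have m8 : (0 : R) < 8 * m%:R by rewrite mulr_gt0 // ltr0n.
(* [t1] bounds the final commutator, [t2] the one after the first dilation
   and [t3] the one of the initial model. *)
have [k1 [u1 [u10 hu1]]] := sqrt_modulus_lt e20.
pose t1 := Num.min u1 eps; have t10 : 0 < t1 by rewrite lt_min u10.
have [k2 [t2 [t20 ht2]]] := sqrt_modulus_lt (divr_gt0 t10 m8).
have [k3 [u3 [u30 hu3]]] := sqrt_modulus_lt (divr_gt0 t20 m8).
pose t3 := Num.min u3 (e / 2); have t30 : 0 < t3 by rewrite lt_min u30.
have [H [V [A [B [fH iV [pA pB] cAB cl]]]]] := hX _ t30.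
have [K1 [J1 [P1 [am1 [fK1 lJ1 iJ1 [pP1 hP1] [ap1 aq1 ae1 ac1]]]]]] :=
  simultaneous_dilation m0 pA fH.
pose B1 l j := am1 (B l j); have pB1 l : povm (B1 l) by exact: ap1.
have [K2 [J2 [Q2 [am2 [fK2 lJ2 iJ2 [pQ2 hQ2] [ap2 aq2 ae2 ac2]]]]]] :=
  simultaneous_dilation m0 pB1 fK1.
pose P2 k i := am2 (P1 k i); have pP2 k : projective_povm (P2 k) by exact: aq2.
have lA k i := povm_lin (pA k) i; have lB k i := povm_lin (pB k) i.
have cA k i := povm_contr (pA k) i; have cB k i := povm_contr (pB k) i.
have c1 k i l j : comm_le (P1 k i) (B1 l j) t2.
  have h : 8 * m%:R * sqrt_modulus k3 t3 <= t2.
    rewrite mulrC -ler_pdivlMr //; apply: le_trans (ltW hu3).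
    by apply: sqrt_modulus_mono; rewrite ge_min lexx.
  move=> x; apply: le_trans (_ : _ <= 8 * m%:R * sqrt_modulus k3 t3 * nrm x) _; last first.
    by rewrite ler_wpM2r ?nrm_ge0.
  apply: ac1 => //; first by rewrite sqrt_modulus_ge0 // ltW.
  move=> i'; apply: sqrt_comm_le => //; first exact: povm_effect.
  exact: ltW.
have c2 k i l j : comm_le (P2 k i) (Q2 l j) t1.
  have h : 8 * m%:R * sqrt_modulus k2 t2 <= t1.
    by rewrite mulrC -ler_pdivlMr // ltW.
  have pP1' := (pP1 k).1.
  apply: comm_sym => x; apply: le_trans (_ : _ <= 8 * m%:R * sqrt_modulus k2 t2 * nrm x) _; last first.
    by rewrite ler_wpM2r ?nrm_ge0.
  apply: ac2; [exact: povm_lin|exact: povm_contr|by rewrite sqrt_modulus_ge0 // ltW|].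
  move=> j'; apply: sqrt_comm_le; [exact: povm_effect|exact: povm_lin|exact: povm_contr|exact: ltW|].
  exact/comm_sym.
have nJ1 x : nrm (J1 x) = nrm x by rewrite /nrm /semi_norm iJ1.
have nJ2 x : nrm (J2 x) = nrm x by rewrite /nrm /semi_norm iJ2.
have [V1 [iV1 V1E]] := isometry_transport lJ1 (fun v => nJ1 (V v)) iV.
have [V2 [iV2 V2E]] := isometry_transport lJ2 (fun v => nJ2 (V1 v)) iV1.
have entry k i l j a b : inner (V2 (delta_mx a 0)) (P2 k i (Q2 l j (V2 (delta_mx b 0)))) =
    inner (V (delta_mx a 0)) (A k i (B l j (V (delta_mx b 0)))).
  have sP := psd_selfadj (povm_psd (pP2 k).1 i).
  have sP1 := psd_selfadj (povm_psd (pP1 k).1 i).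
  rewrite -sP !V2E /P2 ae2 ?hQ2; last exact: povm_lin (pP1 k).1 i.
  by rewrite !V1E /B1 ae1 // sP1 hP1.
have [Y hY] := array_of_blocks (fun k i l j => compression V2 (bullet (P2 k i) (Q2 l j))).
exists Y.
  exists K2, V2, P2, Q2; split => //; split => // k i l j.
  apply: opnorm_le; first exact: ltW.
  move=> x; apply: le_trans (c2 k i l j x) _; rewrite ler_wpM2r ?nrm_ge0 //.
  by rewrite ge_min lexx orbT.
move=> k i l j a b; rewrite hY compressionE.
have -> : e = e / 2 + e / 2 by field.
rewrite -[X in cabs (X - _)](subrK (inner (V2 (delta_mx a 0)) (P2 k i (Q2 l j (V2 (delta_mx b 0)))))).
rewrite -addrA (le_trans (le_normcD _ _)) // lerD //.
  rewrite -(semiB (@inner_semi _ K2)) -/(cabs _) (le_trans (inner_le _ _)) // isometry_nrm // mul1r.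
  have h := bullet_close k1 (povm_effect i (pP2 k).1) (povm_effect j (pQ2 l).1) (ltW t10)
    (c2 k i l j) (V2 (delta_mx b 0)).
  rewrite (le_trans h) // isometry_nrm // mulr1.
  by apply: le_trans (ltW hu1); apply: sqrt_modulus_mono; rewrite ge_min lexx.
rewrite entry; apply: le_trans (cl k i l j a b) _.
by rewrite ge_min lexx orbT.
Qed.

Lemma Qcn1E : Qcn R m d 1 = Qc R m d.
Proof.
apply/seteqP; split=> X.
  move=> [H [V [A [B [iV pA pB cm hX]]]]]; exists H, (V (delta_mx 0 0)), A, B; split => //.
    by rewrite norm_nrmE isometry_nrm.
  move=> k i l j; rewrite hX; apply/matrixP => a b.
  by rewrite compressionE !mxE !ord1 eqxx mulr1n.
move=> [H [xi [A [B [nxi pA pB cm hX]]]]].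
have [V VE] : exists V : {linear 'cV[R[i]]_1 -> H}, forall v : 'cV[R[i]]_1, V v = v 0 0 *: xi.
  by apply: linear_pack => a u v; rewrite !mxE scalerDl scalerA.
exists H, V, A, B; split => //.
  by move=> v; rewrite VE normrZ nxi mulr1 big_ord1.
move=> k i l j; rewrite hX; apply/matrixP => a b.
by rewrite compressionE !VE !mxE !ord1 eqxx mulr1n !scale1r.
Qed.

End Correlations.

Theorem mainTheorem1 (R : realType) (m d : nat)
    (hm : (0 < m)%N) (hd : (0 < d)%N) :
  (forall n : nat, (0 < n)%N ->
     Qcn R m d n = \bigcap_(eps in [set e : R | 0 < e]) Qepsn R m d eps n /\
     \bigcap_(eps in [set e : R | 0 < e]) Qepsn R m d eps n =
       \bigcap_(eps in [set e : R | 0 < e]) Pepsn R m d eps n) /\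
  (Qc R m d = Qs R m d <->
     \bigcap_(eps in [set e : R | 0 < e]) Peps R m d eps `<=` Qs R m d).
Proof.
have QcP n : Qcn R m d n `<=` \bigcap_(eps in [set e : R | 0 < e]) Pepsn R m d eps n.
  move=> X hX eps /= eps0; apply: Pepsn_of_approx => // e e0.
  exact: approx_of_Qcn.
have PQ n : \bigcap_(eps in [set e : R | 0 < e]) Pepsn R m d eps n `<=`
    \bigcap_(eps in [set e : R | 0 < e]) Qepsn R m d eps n.
  by move=> X hX eps /= eps0; apply: Pepsn_sub; exact: hX.
have QQc n : \bigcap_(eps in [set e : R | 0 < e]) Qepsn R m d eps n `<=` Qcn R m d n.
  by move=> X hX; apply: Qcn_of_approx => e e0; apply: approx_of_Qepsn.
split=> [n _|].
  split; apply/seteqP; split.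
  - exact: subset_trans (QcP n) (PQ n).
  - exact: QQc.
  - exact: subset_trans (QQc n) (QcP n).
  - exact: PQ.
have QsQc : Qs R m d `<=` Qc R m d.
  move=> X hX; rewrite -Qcn1E; apply: Qcn_of_approx => e e0.
  have e20 : 0 < e / 2 by rewrite divr_gt0.
  have [Y [H _ hY] XY] := (closure_corrP _ _).1 hX _ e20.
  have -> : e = e / 2 + e / 2 by field.
  apply: approx_near XY (ltW e20) _; apply: approx_of_Qcn => //.
  by rewrite Qcn1E; exists H.
split=> [QcQs|h].
  by rewrite -QcQs -Qcn1E; exact: subset_trans (PQ 1%N) (QQc 1%N).
apply/seteqP; split => //; apply: subset_trans h.
by rewrite -Qcn1E; exact: QcP.
Qed.
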